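(* There exists a constant $C_1=C_1(M,N,w,k)>0$, depending only on $M$, $N$, $w$ and the kernel factors $k=(k^1,k^2)$ (and on the fixed constants $c,C$ in the standing assumption $cm\le n\le Cm$), such that for every $(P,Q)\in\mathcal{P}^{\otimes2}_1$ and every $\lambda=(\lambda_1,\lambda_2)\in(0,\infty)^2$, with independent samples $X_1,\dots,X_n\overset{i.i.d.}{\sim}P$, $Y_1,\dots,Y_m\overset{i.i.d.}{\sim}Q$, $$\mathrm{Var}_{P\times Q}\left(\widehat T_\lambda(\mathbb{X}_n,\mathbb{Y}_m)\right)\le C_1\left(\frac{\|(w\cdot\psi)*\varphi_\lambda\|_2^2}{n+m}+\frac{1}{(n+m)^2\lambda_1\lambda_2}\right),$$ where $\psi=p-q$, $p=\mathbb{E}(P)$, $q=\mathbb{E}(Q)$.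
   Context: **Diagrams and intensities.** $\Omega=\{(x,y)\in\mathbb{R}^2: y>x\ge 0\}$ and, for $M>0$, $\Omega(M)=\{(x,y)\in\Omega:y<M\}$. $\mathbf{PD}$ is the set of locally finite integer-valued (counting) measures on $\Omega$, i.e. persistence diagrams, identified with multisets $D=\sum_{\mathbf{x}\in D}\delta_{\mathbf{x}}$; it carries the $\sigma$-field generated by the maps $D\mapsto D(A)$, $A\subset\Omega$ relatively compact Borel. $|D|$ is the number of points of $D$ with multiplicity. For a random $D$, $\mathbb{E}(D)$ is the measure $A\mapsto\mathbb{E}(D(A))$; if it has a density $p$ with respect to Lebesgue measure $\mathrm{Leb}_2$, $p$ is the persistence intensity function, and if $D\sim P$ one writes $\mathbb{E}(P)=p$. For a filtration $\mathcal{K}(\mathcal{X})=\{\mathcal{K}(\mathcal{X},r)\}_{r>0}$ (increasing family of simplicial complexes built on a point cloud $\mathcal{X}$), $\mathrm{PD}_k(\mathcal{K}(\mathcal{X}))$ is the multiset of (birth, death) pairs in $\Omega$ of its $k$-dimensional persistent homology; the map $\mathcal{X}\mapsto \mathrm{PD}_k(\mathcal{K}(\mathcal{X}))$ is assumed measurable. **Weight.** $w:\Omega(M)\to(0,\infty)$ is smooth, nondecreasing in $y-x$, with $\|w^2\|_\infty<\infty$; it admits a compactly supported smooth extension to $\mathbb{R}^2$, still denoted $w$. **Kernel.** For $i=1,2$, $k^i:\mathbb{R}\to[0,\infty)$ is a positive definite function in $L^1(\mathbb{R})\cap L^2(\mathbb{R})$ with $k^i(x)=k^i(-x)$ and $\int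 k^i=1$. For $\lambda\in(0,\infty)^2$, $\varphi_\lambda(u)=\prod_{i=1}^2\lambda_i^{-1}k^i(u_i/\lambda_i)$ and $k_\lambda(x,y)=\varphi_\lambda(x-y)$. **Class $\mathcal{P}=\mathcal{P}(M,N)$** ($M,N>0$ fixed): all distributions $P$ on $\mathbf{PD}$ such that $D\sim P$ satisfies: (i) $D=\mathrm{PD}_k(\mathcal{K}(\mathcal{X}))$ for some $k\ge0$, some filtration $\mathcal{K}$ and some random point cloud $\mathcal{X}$; (ii) every $(x,y)\in D$ has $y<M$; (iii) there are a discrete random variable $Z$ with values in $\mathbb{N}$ and a function $h:\mathbb{N}\to\mathbb{R}$ such that, conditionally on $Z=\ell$, $|D|\le h(\ell)$; for each $\ell$ the density $p_\ell=d\mathbb{E}[D\mid Z=\ell]/d\mathrm{Leb}_2$ exists; and $\sum_{\ell\ge1}h(\ell)\|w^2 p_\ell\|_\infty\mathbb{P}(Z=\ell)\le N$. $\mathcal{P}_1^{\otimes2}=\{(P,Q)\in\mathcal{P}\times\mathcal{P}: p\ne q,\ \mathbb{E}(P)=p,\ \mathbb{E}(Q)=q\}$. Intensity functions are extended by $0$ to $\mathbb{R}^2$; $*$ is convolution on $\mathbb{R}^2$ and $\|\cdot\|_2$ the $L^2(\mathbb{R}^2)$ norm. **Statistic.** Sample sizes $n,m\ge2$ satisfy $cm\le n\le Cm$ for fixed constants $0<c\le C<\infty$. $\mathbb{X}_n=(X_1,\dots,X_n)$, $\mathbb{Y}_m=(Y_1,\dots,Y_m)$. $K_\lambda(X,Y)=\sum_{\mathbf{z}\in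 X}\sum_{\mathbf{z}'\in Y}w(\mathbf{z})w(\mathbf{z}')k_\lambda(\mathbf{z},\mathbf{z}')$, $h_\lambda(X,X',Y,Y')=K_\lambda(X,X')+K_\lambda(Y,Y')-K_\lambda(X,Y')-K_\lambda(X',Y)$, and $$\widehat T_\lambda(\mathbb{X}_n,\mathbb{Y}_m)=\frac{1}{n(n-1)m(m-1)}\sum_{1\le i\ne i'\le n}\sum_{1\le j\ne j'\le m}h_\lambda(X_i,X_{i'},Y_j,Y_{j'}).$$ *)

(* Defs.v *)
From HB Require Import structures.
From mathcomp Require Import all_boot all_order all_algebra finmap.

Set Implicit Arguments.
Unset Strict Implicit.
Unset Printing Implicit Defensive.

Import Order.TTheory GRing.Theory Num.Theory.

Local Open Scope ring_scope.

(* Finite sets are used here: the analysis libraries, loaded below, rebind set0. *)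
(** * Simplicial homology on a finite vertex set *)

Definition simplicial_complex (V : finType) (K : {set {set V}}) : Prop :=
  set0 \notin K /\
  forall s t : {set V}, s \in K -> t != set0 -> t \subset s -> t \in K.

Section homology.
Variables (F : fieldType) (V : finType).

(* Chains of all degrees at once: a chain is a function on all subsets of V. *)
Definition chain := {ffun {set V} -> F^o}.

Definition simplex_chain (s : {set V}) : chain := [ffun t => (t == s)%:R].

(* [K]-chains of degree k are spanned by the simplices with k+1 vertices. *)
Definition chains (k : nat) (K : {set {set V}}) : {vspace chain} :=
  <<[seq simplex_chain s | s <- enum [set s in K | #|s| == k.+1]]>>%VS.

(* Simplices are oriented by the enumeration order of V; the coefficient of the
   boundary of c on the face t is the sum over the vertices v missing from t of
   (-1)^(position of v in t + v) times the coefficient of c on t + v.  The empty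
   face gets 0: homology is not reduced. *)
Definition boundary_fun (c : chain) : chain :=
  [ffun t : {set V} => if t == set0 then 0 else
    \sum_(v | v \notin t)
      (-1) ^+ #|[set u in t | (enum_rank u < enum_rank v)%N]| * c (v |: t)].

Lemma boundary_fun_linear : linear boundary_fun.
Proof.
move=> a c c'; apply/ffunP => t; rewrite !ffunE.
case: ifP => _; first by rewrite scaler0 addr0.
rewrite scaler_sumr -big_split /=; apply: eq_bigr => v _.
by rewrite !ffunE mulrDr /GRing.scale /= mulrCA.
Qed.

HB.instance Definition _ :=
  GRing.isLinear.Build F chain chain _ boundary_fun boundary_fun_linear.

Definition boundary : 'End(chain) := linfun boundary_fun.

Definition cycles (k : nat) (K : {set {set V}}) : {vspace chain} :=
  (chains k K :&: lker boundary)%VS.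

Definition boundaries (k : nat) (K : {set {set V}}) : {vspace chain} :=
  (boundary @: chains k.+1 K)%VS.

(* The rank of the map H_k(K) -> H_k(L) induced by the inclusion of K in L,
   whose image is Z_k(K) / (Z_k(K) :&: B_k(L)). *)
Definition persistent_betti (k : nat) (K L : {set {set V}}) : nat :=
  \dim (cycles k K) - \dim (cycles k K :&: boundaries k L)%VS.

End homology.

From mathcomp Require Import all_classical all_reals all_analysis.
From mathcomp Require Import measurable_realfun.

Import numFieldNormedType.Exports.

Local Open Scope classical_set_scope.
Local Open Scope ring_scope.

(* [measurableTypeR R] is R with the very Borel structure on which
   [lebesgue_measure] is declared, so that the product measure below applies. *)
Notation plane R := (measurableTypeR R * measurableTypeR R)%type.

Definition leb2 (R : realType) : {measure set (plane R) -> \bar R} :=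
  (@lebesgue_measure R \x @lebesgue_measure R)%E.
Arguments leb2 {R}.

Definition Omega (R : realType) : set (plane R) :=
  [set z | 0 <= (z.1 : R) /\ (z.1 : R) < z.2].
Arguments Omega {R}.

Definition OmegaM (R : realType) (M : R) : set (plane R) :=
  [set z | Omega z /\ (z.2 : R) < M].

(** * Persistence diagrams *)

(* A is relatively compact as a subset of Omega (not of the whole plane:
   points may accumulate at the diagonal). *)
Definition relatively_compact (R : realType) (A : set (plane R)) : Prop :=
  exists L : set (R * R),
    [/\ compact L, L `<=` (Omega : set (R * R)) & A `<=` (L : set (plane R))].

(* A measure on Omega is encoded as a measure on the plane that does not charge
   the complement of Omega. *)
Record persdiag (R : realType) := Persdiag {
  pd_measure :> {measure set (plane R) -> \bar R} ;
  pd_support : pd_measure (~` Omega) = 0%E ;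
  pd_integer : forall A, measurable A ->
    pd_measure A = +oo%E \/ exists n : nat, pd_measure A = n%:R%:E ;
  pd_locally_finite : forall A, measurable A -> relatively_compact A ->
    (pd_measure A < +oo)%E }.

Section empty_persdiag.
Variable R : realType.
Let m0 : {measure set (plane R) -> \bar R} := mzero.

Let m0_support : m0 (~` Omega) = 0%E. Proof. by []. Qed.

Let m0_integer (A : set (plane R)) : measurable A ->
  m0 A = +oo%E \/ exists n : nat, m0 A = n%:R%:E.
Proof. by right; exists 0. Qed.

Let m0_locally_finite (A : set (plane R)) :
  measurable A -> relatively_compact A -> (m0 A < +oo)%E.
Proof. by move=> _ _; exact: ltry. Qed.

Definition empty_persdiag : persdiag R :=
  Persdiag m0_support m0_integer m0_locally_finite.
End empty_persdiag.

HB.instance Definition _ (R : realType) := gen_eqMixin (persdiag R).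
HB.instance Definition _ (R : realType) := gen_choiceMixin (persdiag R).
HB.instance Definition _ (R : realType) :=
  isPointed.Build (persdiag R) (empty_persdiag R).

Definition persdiag_gen (R : realType) : set (set (persdiag R)) :=
  [set E | exists A : set (plane R), exists B : set (\bar R),
     [/\ measurable A, relatively_compact A, measurable B
       & E = [set D : persdiag R | B (D A)] ] ].

Notation PD R := (g_sigma_algebraType (@persdiag_gen R)).

Definition pd_eval (R : realType) (D : PD R) : {measure set (plane R) -> \bar R} :=
  pd_measure D.

(** * Persistence diagram of a filtration *)

Section persistence_diagram.
Variables (R : realType) (F : fieldType) (V : finType).

Definition filtration (K : R -> {set {set V}}) : Prop :=
  (forall r, 0 < r -> simplicial_complex (K r)) /\
  (forall r s, 0 < r -> r <= s -> K r \subset K s).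

Definition filtration_betti (k : nat) (K : R -> {set {set V}}) (r s : R) : nat :=
  let at_ u := if 0 < u then K u else finset.set0 in
  persistent_betti F k (at_ r) (at_ s).

(* The number m of classes born at b and dying at d is
   beta(b+e, d-e) - beta(b-e, d-e) + beta(b-e, d+e) - beta(b+e, d+e)
   for all small e > 0 (Cohen-Steiner, Edelsbrunner and Harer); the identity is
   written without subtraction.  Classes that never die are not in Omega. *)
Definition is_persistence_diagram (k : nat) (K : R -> {set {set V}})
    (D : PD R) : Prop :=
  forall b d : R, Omega (b, d) -> exists m : nat,
    pd_eval D [set (b, d)] = m%:R%:E /\
    \forall e \near (0 : R)^'+,
      (filtration_betti k K (b + e) (d - e)
         + filtration_betti k K (b - e) (d + e)
       = m + filtration_betti k K (b - e) (d - e)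
           + filtration_betti k K (b + e) (d + e))%N.

End persistence_diagram.

(** * Random point clouds *)

Definition cloud_gen d (S : measurableType d) : set (set {fset S}) :=
  [set E | exists A : set S, exists n : nat, measurable A /\
     E = [set X : {fset S} | #|` [fset x in X | x \in A]%fset| = n] ].

Notation cloud_space S := (g_sigma_algebraType (@cloud_gen _ S)).

Definition arises_from_cloud (R : realType) (F : fieldType)
    d (T : measurableType d) (D : T -> PD R) : Prop :=
  exists dS (S : measurableType dS) (X : T -> cloud_space S) (k : nat)
    (K : forall x : {fset S}, R -> {set {set x}}) (PDk : cloud_space S -> PD R),
    [/\ measurable_fun setT X,
        forall x, filtration (K x),
        forall x : {fset S}, is_persistence_diagram F k (K x) (PDk x),
        measurable_fun setT PDk
      & forall t, D t = PDk (X t)].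

(** * Intensities and the class of distributions *)

Definition is_density (R : realType) (nu : set (plane R) -> \bar R)
    (p : plane R -> R) : Prop :=
  [/\ measurable_fun setT p,
      forall z, 0 <= p z,
      forall z, ~ Omega z -> p z = 0
    & forall A, measurable A -> A `<=` Omega ->
        nu A = (\int[leb2]_(z in A) (p z)%:E)%E].

Definition is_intensity (R : realType) (P : probability (PD R) R)
    (p : plane R -> R) : Prop :=
  is_density (fun A => \int[P]_D pd_eval D A)%E p.

Definition conditional_mean (R : realType) d (T : measurableType d)
    (Pr : probability T R) (D : T -> PD R) (E : set T) (A : set (plane R)) :
    \bar R :=
  (((fine (Pr E))^-1)%:E * \int[Pr]_(t in E) pd_eval (D t) A)%E.

(* Z takes its values in {1, 2, ...}.  Nothing is required of p_l when Z = l has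
   probability zero, and then the l-th term of the series vanishes. *)
Definition conditionally_bounded (R : realType) (N : R)
    d (T : measurableType d) (Pr : probability T R) (w : plane R -> R)
    (D : T -> PD R) : Prop :=
  exists (Z : T -> nat) (h : nat -> R) (p_ : nat -> plane R -> R),
    [/\ measurable_fun setT Z /\ (forall t, (0 < Z t)%N),
        {ae Pr, forall t, (pd_eval (D t) setT <= (h (Z t))%:E)%E},
        forall l, (0 < Pr (Z @^-1` [set l]))%E ->
          is_density (conditional_mean Pr D (Z @^-1` [set l])) (p_ l)
      & (\sum_(1 <= l <oo)
           ((h l)%:E * 'N[leb2]_+oo[(fun z => ((w z) ^+ 2 * p_ l z)%:E)]
              * Pr (Z @^-1` [set l])) <= N%:E)%E].

(* F is the field of coefficients of the homology. *)
Definition classP (R : realType) (F : fieldType) (M N : R) (w : plane R -> R)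
    (P : probability (PD R) R) : Prop :=
  exists d (T : measurableType d) (Pr : probability T R) (D : T -> PD R),
    [/\ measurable_fun setT D
          /\ (forall B, measurable B -> Pr (D @^-1` B) = P B),
        arises_from_cloud F D,
        {ae Pr, forall t, pd_eval (D t) (~` OmegaM M) = 0%E}
      & conditionally_bounded N Pr w D].

(** * Weight and kernel *)

Fixpoint continuously_differentiable (R : realType) (n : nat) (f : R * R -> R) :
    Prop :=
  if n is n'.+1 then
    (forall z, differentiable f z) /\
    (forall v, continuously_differentiable n' ('D_v f))
  else continuous f.

Definition smooth (R : realType) (f : R * R -> R) : Prop :=
  forall n, continuously_differentiable n f.

(* w is the extension to the whole plane. *)
Definition weight (R : realType) (M : R) (w : plane R -> R) : Prop :=
  [/\ smooth (w : R * R -> R) /\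
      compact (closure [set z : R * R | (w : R * R -> R) z != 0]),
      forall z, OmegaM M z -> 0 < w z,
      forall z z', OmegaM M z -> OmegaM M z' ->
        (z.2 : R) - z.1 <= (z'.2 : R) - z'.1 -> w z <= w z'
    & exists B : R, forall z, OmegaM M z -> (w z) ^+ 2 <= B].

Definition positive_definite_fun (R : realType) (k : R -> R) : Prop :=
  forall (n : nat) (x a : 'I_n -> R),
    0 <= \sum_(i < n) \sum_(j < n) a i * a j * k (x i - x j).

Definition kernel_factor (R : realType) (k : measurableTypeR R -> R) : Prop :=
  [/\ forall x, 0 <= k x,
      positive_definite_fun (k : R -> R),
      (k \in Lfun lebesgue_measure 1) /\ (k \in Lfun lebesgue_measure 2%:E),
      forall x : R, k (- x) = k x
    & \int[lebesgue_measure]_x k x = 1].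

Section statistic.
Variables (R : realType) (w : plane R -> R) (k1 k2 : R -> R) (lam : R * R).

Definition phi (u : plane R) : R :=
  (lam.1^-1 * k1 (u.1 / lam.1)) * (lam.2^-1 * k2 (u.2 / lam.2)).

Definition klam (x y : plane R) : R := phi ((x.1 : R) - y.1, (x.2 : R) - y.2).

(* The double sum over the points of X and Y, counted with multiplicity, is the
   double integral against the counting measures X and Y. *)
Definition Klam (X Y : PD R) : R :=
  fine (\int[pd_eval X]_z \int[pd_eval Y]_z' (w z * w z' * klam z z')%:E)%E.

Definition hlam (X X' Y Y' : PD R) : R :=
  Klam X X' + Klam Y Y' - Klam X Y' - Klam X' Y.

Definition That (n m : nat) (X : 'I_n -> PD R) (Y : 'I_m -> PD R) : R :=
  (n%:R * (n%:R - 1) * m%:R * (m%:R - 1))^-1 *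
  \sum_(i < n) \sum_(i' < n | i != i') \sum_(j < m) \sum_(j' < m | j != j')
    hlam (X i) (X i') (Y j) (Y j').

End statistic.

Definition convolution (R : realType) (f g : plane R -> R) (x : plane R) : R :=
  \int[leb2]_z (f z * g ((x.1 : R) - z.1, (x.2 : R) - z.2)).

(** * Samples *)

(* Some of the A i may be the whole space, so this covers all subfamilies. *)
Definition mutually_independent (R : realType) d (T : measurableType d)
    (Pr : probability T R) d' (E : measurableType d') (I : finType)
    (X : I -> T -> E) : Prop :=
  forall A : I -> set E, (forall i, measurable (A i)) ->
    Pr (\bigcap_i (X i @^-1` A i)) = (\prod_i Pr (X i @^-1` A i))%E.

Definition independent_samples (R : realType) d (T : measurableType d)
    (Pr : probability T R) (P Q : probability (PD R) R) (n m : nat)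
    (X : 'I_n -> T -> PD R) (Y : 'I_m -> T -> PD R) : Prop :=
  [/\ forall i, measurable_fun setT (X i)
        /\ (forall B, measurable B -> Pr (X i @^-1` B) = P B),
      forall j, measurable_fun setT (Y j)
        /\ (forall B, measurable B -> Pr (Y j @^-1` B) = Q B)
    & mutually_independent Pr
        (fun s : 'I_n + 'I_m => match s with inl i => X i | inr j => Y j end)].

(* Main.v *)
Require Import Defs.
From HB Require Import structures.
From mathcomp Require Import all_boot all_order all_algebra finmap.
From mathcomp Require Import all_classical all_reals all_analysis.
From mathcomp Require Import measurable_realfun ess_sup_inf.
From mathcomp Require Import ring lra.

Set Implicit Arguments.
Unset Strict Implicit.
Unset Printing Implicit Defensive.

Import Order.TTheory GRing.Theory Num.Theory numFieldNormedType.Exports.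

Local Open Scope classical_set_scope.
Local Open Scope ring_scope.

(** The statistic is a quadratic form in the independent diagrams, so it has a
    Hoeffding decomposition into uncorrelated linear and completely degenerate
    parts, and its variance is controlled by the second moments of the first
    projections and of the kernel [K].  Both come from a single estimate: by
    Cauchy-Schwarz, [(D(w u))^2 <= |D| D(w^2 u^2)], hence, conditioning on Z,
    [E (D(w u))^2 <= N * \int_OmegaM u^2] for every measurable [u].  Applied to
    the potential [z |-> \int w(z') k_lambda(z, z') Y(dz')] of a diagram [Y], and
    once more to that potential as a function of [Y], it gives
    [E K^2 <= N^2 M^2 |phi_lambda|_2^2], of order [1 / (lam1 lam2)].  The first
    projection is, up to a constant, [D(w f) / n] with
    [f = (w psi) * phi_lambda], and the estimate bounds its second moment by
    [N |f|_2^2 / n^2]. *)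

(** * Integrals and second moments *)

(** The Hoeffding argument wants a kernel that is finite, nonnegative, symmetric and jointly
    measurable on all pairs of diagrams. [Klam] is under control only for diagrams that are finite
    and carried by [OmegaM M]: elsewhere its integrals may be infinite, in which case [fine] returns
    0, and the extension of [w] may be negative. Hence [Kfine], built from [pdfin] and
    [trunc_weight], which agrees with [Klam] on the almost sure event [regular_pd]. The statistic
    itself is not shown to be measurable, so this replacement goes through comparisons of integrals
    that ask measurability of one side only. The factor M^2 bounds the area of [OmegaM M], over
    which a bound uniform in z is integrated. Only psi enters the linear part because the weights of
    the quadratic form sum to zero along each row. The numerical constants are not optimised; they
    come mostly from (a + b)^2 <= 2 a^2 + 2 b^2. *)

Section integral_without_measurability.
Local Open Scope ereal_scope.
Context d (T : measurableType d) (R : realType).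
Variable mu : {measure set T -> \bar R}.
Implicit Types f g : T -> \bar R.

(** The integral of a nonnegative function is a supremum over the simple functions below it, and
    this supremum is monotone whether or not the function is measurable. *)
Lemma ge0_le_integral_any f g : (forall x, 0 <= f x) ->
  (forall x, f x <= g x) -> \int[mu]_x f x <= \int[mu]_x g x.
Proof.
move=> f0 fg; have g0 x : 0 <= g x by exact: le_trans (fg x).
rewrite !ge0_integralTE//; apply: le_ereal_sup => _ [h hf <-]; exists h => //.
by move=> x; exact: le_trans (hf x) (fg x).
Qed.

(** With A the exceptional null set, f lies between the measurable functions g restricted to the
    complement of A and g + oo * 1_A, and both have the integral of g. *)
Lemma ge0_ae_eq_integral_any f g : measurable_fun setT g ->
  (forall x, 0 <= f x) -> (forall x, 0 <= g x) ->
  {ae mu, forall x, f x = g x} -> \int[mu]_x f x = \int[mu]_x g x.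
Proof.
move=> mg f0 g0 [A [mA A0 fgA]].
have fgC x : ~ A x -> f x = g x.
  by move=> nAx; apply: contrapT => fgx; apply: nAx; exact: fgA.
apply/eqP; rewrite eq_le; apply/andP; split.
  have mgA : measurable_fun setT (fun x => g x + +oo * (\1_A x)%:E).
    apply: emeasurable_funD => //; apply: emeasurable_funM => //.
    exact/measurable_EFinP/measurable_indic.
  apply: (@le_trans _ _ (\int[mu]_x (g x + +oo * (\1_A x)%:E))).
    apply: ge0_le_integral_any => // x.
    have [xA|xA] := boolP (x \in A).
      by rewrite indicE xA mule1 addey ?leey//; apply: contraTneq (g0 x) => ->.
    rewrite indicE (negbTE xA) mule0 adde0 fgC //.
    by move/mem_set; exact/negP.
  rewrite le_eqVlt; apply/orP; left; apply/eqP.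
  apply: ge0_ae_eq_integral => //.
    by move=> x _; rewrite adde_ge0// mule_ge0// ?lee_fin.
  exists A; split => // x /= h; apply: contrapT => nAx; apply: h => _.
  by rewrite indicE memNset// mule0 adde0.
have mgA : measurable_fun setT (g \_ (~` A)).
  by apply/(measurable_restrictT _ _).1; [exact: measurableC|exact: measurable_funTS].
apply: (@le_trans _ _ (\int[mu]_x (g \_ (~` A)) x)).
  rewrite le_eqVlt; apply/orP; left; apply/eqP.
  apply: ge0_ae_eq_integral => //.
    by move=> x _; apply: erestrict_ge0.
  exists A; split => // x /= h; apply: contrapT => nAx; apply: h => _.
  by rewrite patchE mem_set.
apply: ge0_le_integral_any => x; first exact: erestrict_ge0.
rewrite patchE; case: ifPn => // /set_mem nAx.
by rewrite fgC.
Qed.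

Lemma ae_eq_integral_any f g : measurable_fun setT g ->
  {ae mu, forall x, f x = g x} -> \int[mu]_x f x = \int[mu]_x g x.
Proof.
move=> mg fg; rewrite integralE [RHS]integralE; congr (_ - _).
- apply: ge0_ae_eq_integral_any => //; first exact: measurable_funepos.
  by apply: filterS fg => x fgx; rewrite !funeposE fgx.
- apply: ge0_ae_eq_integral_any => //; first exact: measurable_funeneg.
  by apply: filterS fg => x fgx; rewrite !funenegE fgx.
Qed.

End integral_without_measurability.

Section square_integrable.
Local Open Scope ereal_scope.
Context d (T : measurableType d) (R : realType) (Pr : probability T R).

Lemma integrable_prod_of_sqr (f g : T -> R) :
  measurable_fun setT f -> measurable_fun setT g ->
  \int[Pr]_t (f t ^+ 2)%:E < +oo -> \int[Pr]_t (g t ^+ 2)%:E < +oo ->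
  Pr.-integrable setT (fun t => (f t * g t)%:E).
Proof.
move=> mf mg f2 g2; apply/integrableP; split.
  by apply/measurable_EFinP; exact: measurable_funM.
apply: (@le_lt_trans _ _ (\int[Pr]_t ((f t ^+ 2)%:E + (g t ^+ 2)%:E))).
  apply: ge0_le_integral => //.
  - by apply: measurableT_comp => //; apply/measurable_EFinP; exact: measurable_funM.
  - by apply: emeasurable_funD; apply/measurable_EFinP; exact: measurable_funX.
  - move=> t _; rewrite -EFinD lee_fin normrM.
    have := sqr_ge0 (`|f t| - `|g t|)%R; rewrite sqrrB !real_normK ?num_real//.
    have := sqr_ge0 (f t); have := sqr_ge0 (g t); lra.
rewrite ge0_integralD//.
- by rewrite lte_add_pinfty.
- by move=> t _; rewrite lee_fin sqr_ge0.
- by apply/measurable_EFinP; exact: measurable_funX.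
- by move=> t _; rewrite lee_fin sqr_ge0.
- by apply/measurable_EFinP; exact: measurable_funX.
Qed.

Lemma integrable_of_sqr (f : T -> R) : measurable_fun setT f ->
  \int[Pr]_t (f t ^+ 2)%:E < +oo -> Pr.-integrable setT (EFin \o f).
Proof.
move=> mf f2.
have -> : EFin \o f = (fun t => (f t * (cst 1 t))%:E).
  by apply/funext => t /=; rewrite mulr1.
apply: integrable_prod_of_sqr => //.
under eq_integral do rewrite /= expr1n.
by rewrite integral_cst// mul1e (le_lt_trans (probability_le1 _ _))// ltry.
Qed.

(* Pairing each index with its image under an involution absorbs the terms
   that need not be orthogonal. *)
Lemma second_moment_sum_le (J : finType) (s : J -> J) (V : J -> T -> R) :
  involutive s -> (forall j, measurable_fun setT (V j)) ->
  (forall j, \int[Pr]_t (V j t ^+ 2)%:E < +oo) ->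
  (forall i j, j != i -> j != s i -> \int[Pr]_t (V i t * V j t)%:E = 0) ->
  \int[Pr]_t ((\sum_j V j t) ^+ 2)%:E
    <= 2%:E * \sum_j \int[Pr]_t (V j t ^+ 2)%:E.
Proof.
move=> sK mV V2 Vorth.
have iV i j := integrable_prod_of_sqr (mV i) (mV j) (V2 i) (V2 j).
pose e i j := fine (\int[Pr]_t (V i t * V j t)%:E).
have eE i j : \int[Pr]_t (V i t * V j t)%:E = (e i j)%:E.
  by rewrite fineK//; exact: integrable_fin_num.
have eE2 i : \int[Pr]_t (V i t ^+ 2)%:E = (e i i)%:E.
  by rewrite -eE; apply: eq_integral => t _; rewrite expr2.
have -> : \int[Pr]_t ((\sum_j V j t) ^+ 2)%:E = (\sum_i \sum_j e i j)%:E.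
  under eq_integral do rewrite expr2 mulr_suml -sumEFin.
  rewrite integral_sum//; last first.
    move=> i; under eq_fun do rewrite mulr_sumr -sumEFin.
    exact: integrable_sum.
  rewrite -sumEFin; apply: eq_bigr => i _.
  under eq_integral do rewrite mulr_sumr -sumEFin.
  rewrite integral_sum//.
  by rewrite -sumEFin; apply: eq_bigr => j _; rewrite eE.
rewrite (eq_bigr (fun i => (e i i)%:E)) => [|i _]; last exact: eE2.
rewrite sumEFin -EFinM lee_fin.
have e0 i : (0 <= e i i)%R.
  by rewrite -lee_fin -eE2 integral_ge0// => t _; rewrite lee_fin sqr_ge0.
(* A row of the Gram matrix has at most two nonzero entries, the diagonal one and the one at [s i],
   and the latter is at most the mean of two diagonal entries. Summed over i, the entries at [s i]
   reindex to the diagonal sum. *)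
have ein i : (\sum_j e i j <= e i i + (e i i + e (s i) (s i)) / 2)%R.
  have e2 : (e i (s i) <= (e i i + e (s i) (s i)) / 2)%R.
    rewrite -lee_fin -eE EFinM EFinD -!eE2 -ge0_integralD//; last 4 first.
      + by move=> t _; rewrite lee_fin sqr_ge0.
      + by apply/measurable_EFinP; exact: measurable_funX.
      + by move=> t _; rewrite lee_fin sqr_ge0.
      + by apply/measurable_EFinP; exact: measurable_funX.
    have i2 j : Pr.-integrable setT (fun t => (V j t ^+ 2)%:E).
      by under eq_fun do rewrite expr2; exact: iV.
    rewrite -integralZr//; last exact: integrableD.
    apply: le_integral => //.
      by apply: integrableZr => //; exact: integrableD.
    move=> t _; rewrite -EFinD -EFinM lee_fin.
    have := sqr_ge0 (V i t - V (s i) t); rewrite sqrrB; lra.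
  rewrite (bigD1 i)//= lerD2l.
  have [si|si] := eqVneq (s i) i.
    rewrite big1; first by have := e0 i; have := e0 (s i); lra.
    move=> j ji; rewrite /e Vorth// ?si//.
  rewrite (bigD1 (s i))//= big1 ?addr0// => j /andP[ji jsi].
  by rewrite /e Vorth.
apply: le_trans (ler_sum _ (fun i _ => ein i)) _.
rewrite big_split/= -mulr_suml big_split/=.
have -> : (\sum_i e (s i) (s i) = \sum_i e i i)%R.
  by rewrite [RHS](reindex_inj (inv_inj sK)).
set S := (\sum_i _)%R; lra.
Qed.

End square_integrable.

Section second_moments.
Local Open Scope ereal_scope.
Context d (T : measurableType d) (R : realType).

Lemma poweR2 (x : \bar R) : 0 <= x -> x `^ 2 = x ^+ 2.
Proof.
case: x => [r r0||//]; last by rewrite poweRyr.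
by rewrite poweR_EFin powR_mulrn.
Qed.

(** Cauchy-Schwarz against the constant 1. For a counting measure the total mass is the number of
    points; for a probability this is Jensen's inequality. *)
Lemma sqr_integral_le (mu : {measure set T -> \bar R}) (f : T -> R) :
  measurable_fun setT f ->
  (\int[mu]_t `|f t|%:E) ^+ 2 <= mu setT * \int[mu]_t (f t ^+ 2)%:E.
Proof.
move=> mf.
have h2 : (0 < 2 :> R)%R by [].
have := @hoelder _ _ _ mu f (cst 1%R) 2 2 mf (measurable_cst _) h2 h2.
have -> : (2^-1 + 2^-1 = 1 :> R)%R by lra.
move=> /(_ erefl).
rewrite Lnorm1 => H.
have H2 : (\int[mu]_t `|f t|%:E) ^+ 2
    <= ('N[mu]_2%:E[EFin \o f] * 'N[mu]_2%:E[EFin \o (cst 1%R : T -> R)]) ^+ 2.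
  rewrite !expe2; apply: lee_pmul.
  - by apply: integral_ge0.
  - by apply: integral_ge0.
  - apply: le_trans H; rewrite le_eqVlt; apply/orP; left; apply/eqP.
    by apply: eq_integral => t _ /=; rewrite mulr1.
  - apply: le_trans H; rewrite le_eqVlt; apply/orP; left; apply/eqP.
    by apply: eq_integral => t _ /=; rewrite mulr1.
apply: (le_trans H2); rewrite expe2 muleACA -!expe2 muleC.
rewrite -2?poweR2 ?Lnorm_ge0// !powR_Lnorm//.
rewrite le_eqVlt; apply/orP; left; apply/eqP; congr (_ * _).
  under eq_integral do rewrite /= normr1 powR1.
  by rewrite integral_cst// mul1e.
by apply: eq_integral => t _; rewrite /= powR_mulrn// real_normK ?num_real.
Qed.

Variable Pr : probability T R.

Lemma integral_probability_cst (r : R) : \int[Pr]_t r%:E = r%:E.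
Proof.
rewrite integral_cst//.
by transitivity (r%:E * 1); [congr (_ * _); exact: probability_setT|rewrite mule1].
Qed.

Definition sqr_integrable (f : T -> R) :=
  measurable_fun setT f /\ \int[Pr]_t (f t ^+ 2)%:E < +oo.

Lemma measurable_sqr (f : T -> R) : measurable_fun setT f ->
  measurable_fun setT (fun t => (f t ^+ 2)%:E).
Proof. by move=> mf; apply/measurable_EFinP; exact: measurable_funX. Qed.

Lemma sqr_integrable_integrable f : sqr_integrable f ->
  Pr.-integrable setT (EFin \o f).
Proof. by case=> mf f2; exact: integrable_of_sqr. Qed.

Lemma sqr_integrableM f g : sqr_integrable f -> sqr_integrable g ->
  Pr.-integrable setT (fun t => (f t * g t)%:E).
Proof. by case=> mf f2 [mg g2]; exact: integrable_prod_of_sqr. Qed.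

Lemma sqr_integral_addn_le (f g : T -> R) :
  measurable_fun setT f -> measurable_fun setT g ->
  \int[Pr]_t ((f t + g t) ^+ 2)%:E
    <= 2%:E * (\int[Pr]_t (f t ^+ 2)%:E + \int[Pr]_t (g t ^+ 2)%:E).
Proof.
move=> mf mg; rewrite -ge0_integralD//; last 4 first.
- by move=> t _; rewrite lee_fin sqr_ge0.
- exact: measurable_sqr.
- by move=> t _; rewrite lee_fin sqr_ge0.
- exact: measurable_sqr.
rewrite -ge0_integralZl//; last 2 first.
- by apply: emeasurable_funD; exact: measurable_sqr.
- by move=> t _; rewrite adde_ge0// lee_fin sqr_ge0.
apply: ge0_le_integral => //.
- by move=> t _; rewrite lee_fin sqr_ge0.
- by apply: measurable_sqr; exact: measurable_funD.
- apply: emeasurable_funM => //.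
  by apply: emeasurable_funD; exact: measurable_sqr.
- move=> t _; rewrite -EFinD -EFinM lee_fin.
  have := sqr_ge0 (f t - g t)%R; rewrite sqrrB sqrrD; lra.
Qed.

Lemma sqr_integrableD f g : sqr_integrable f -> sqr_integrable g ->
  sqr_integrable (fun t => f t + g t)%R.
Proof.
move=> [mf f2] [mg g2]; split; first exact: measurable_funD.
apply: le_lt_trans (sqr_integral_addn_le mf mg) _.
by rewrite lte_mul_pinfty// lte_add_pinfty.
Qed.

Lemma sqr_integralZ c (f : T -> R) : measurable_fun setT f ->
  \int[Pr]_t ((c * f t) ^+ 2)%:E = (c ^+ 2)%:E * \int[Pr]_t (f t ^+ 2)%:E.
Proof.
move=> mf; rewrite -ge0_integralZl//.
- by apply: eq_integral => t _; rewrite exprMn.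
- exact: measurable_sqr.
- by move=> t _; rewrite lee_fin sqr_ge0.
- by rewrite lee_fin sqr_ge0.
Qed.

Lemma sqr_integrableZ c f : sqr_integrable f ->
  sqr_integrable (fun t => c * f t)%R.
Proof.
move=> [mf f2]; split; first exact: measurable_funM.
by rewrite sqr_integralZ// lte_mul_pinfty// lee_fin sqr_ge0.
Qed.

Lemma sqr_integrable_cst c : sqr_integrable (fun=> c).
Proof.
split; first exact: measurable_cst.
by rewrite integral_probability_cst ltry.
Qed.

Lemma sqr_integrable_sum (J : Type) (r : seq J) (f : J -> T -> R) :
  (forall j, sqr_integrable (f j)) ->
  sqr_integrable (fun t => \sum_(j <- r) f j t)%R.
Proof.
move=> f2; elim: r => [|j r IH].
  by under eq_fun do rewrite big_nil; exact: sqr_integrable_cst.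
by under eq_fun do rewrite big_cons; exact: sqr_integrableD.
Qed.

Lemma integral_sqr_le (f : T -> R) : sqr_integrable f ->
  ((fine (\int[Pr]_t (f t)%:E)) ^+ 2)%:E <= \int[Pr]_t (f t ^+ 2)%:E.
Proof.
move=> f2; have [mf _] := f2.
have := sqr_integral_le Pr mf.
have -> : (Pr : {measure set T -> \bar R}) setT = 1 by exact: probability_setT.
rewrite mul1e; apply: le_trans.
have if_ := sqr_integrable_integrable f2.
have f_fin := integrable_fin_num measurableT if_.
have le := le_abse_integral Pr measurableT (measurable_int _ if_).
have lef : `|fine (\int[Pr]_t (f t)%:E)|%:E <= \int[Pr]_t `|f t|%:E.
  by rewrite -[leLHS]/(`|(fine (\int[Pr]_t (f t)%:E))%:E|) fineK.
rewrite -real_normK ?num_real// expr2 EFinM expe2.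
by apply: lee_pmul.
Qed.

(** The constant 1 would be optimal; 4 results from splitting the square and bounding the squared
    mean by the second moment. *)
Lemma sqr_integral_centered_le (f : T -> R) : sqr_integrable f ->
  \int[Pr]_t ((f t - fine (\int[Pr]_t (f t)%:E)) ^+ 2)%:E
    <= 4%:E * \int[Pr]_t (f t ^+ 2)%:E.
Proof.
move=> f2; have [mf _] := f2; set m := fine _.
apply: le_trans (sqr_integral_addn_le mf (measurable_cst (- m)%R)) _.
have -> : 4%:E = 2%:E * 2%:E :> \bar R by rewrite -EFinM; congr (_%:E); lra.
rewrite -muleA lee_pmul2l//.
rewrite /= integral_probability_cst sqrrN.
rewrite [leRHS](_ : _ = \int[Pr]_t (f t ^+ 2)%:E + \int[Pr]_t (f t ^+ 2)%:E).
  by rewrite leeD2l// integral_sqr_le.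
by rewrite -[2%:E]/((1 + 1)%:E) EFinD ge0_muleDl// mul1e.
Qed.

(** Variance is invariant under translation, so f may be shifted by any a, in practice the constant
    of the Hoeffding decomposition. *)
Lemma variance_le (f : T -> R) (a : R) : sqr_integrable f ->
  variance Pr f <= 4%:E * \int[Pr]_t ((f t - a) ^+ 2)%:E.
Proof.
move=> f2; rewrite /variance unlock expectation.unlock.
have fa2 : sqr_integrable (fun t => f t - a)%R.
  by apply: sqr_integrableD => //; exact: sqr_integrable_cst.
apply: le_trans (sqr_integral_centered_le fa2).
rewrite le_eqVlt; apply/orP; left; apply/eqP.
apply: eq_integral => t _ /=; congr (_%:E).
rewrite fctE/= -expr2; congr (_ ^+ 2)%R.
have -> : \int[Pr]_t (f t - a)%:E = \int[Pr]_t (f t)%:E - a%:E.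
  rewrite integralB_EFin//; last 2 first.
  - exact: sqr_integrable_integrable.
  - by apply: sqr_integrable_integrable; exact: sqr_integrable_cst.
  by rewrite integral_probability_cst.
have ff := integrable_fin_num measurableT (sqr_integrable_integrable f2).
rewrite [X in _ = (_ - X)%R]fineD//=; set u := fine _. ring.
Qed.

End second_moments.

(** * Independence and the Hoeffding decomposition *)

Section law.
Local Open Scope ereal_scope.
Context (R : realType) d (T : measurableType d) d' (E : measurableType d').

(** The image measure is given by its values only, so that the lemma serves both for the laws of the
    samples and for affine substitutions in Lebesgue measure. *)
Lemma ge0_integral_image (mu : {measure set T -> \bar R})
    (nu : {measure set E -> \bar R}) (X : T -> E) (f : E -> \bar R) :
  measurable_fun setT X ->
  (forall B, measurable B -> mu (X @^-1` B) = nu B) ->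
  measurable_fun setT f -> (forall x, 0 <= f x) ->
  \int[mu]_t f (X t) = \int[nu]_x f x.
Proof.
move=> mX lawX mf f0; pose X' := HB.pack_for {mfun T >-> E} X
  (isMeasurableFun.Build _ _ _ _ _ mX).
transitivity (\int[pushforward mu X']_x f x).
  by rewrite ge0_integral_pushforward// preimage_setT.
by apply: eq_measure_integral => A mA _; exact: lawX.
Qed.

End law.

Section independence.
Local Open Scope ereal_scope.
Context (R : realType) d (T : measurableType d) (Pr : probability T R).
Context d' (E : measurableType d') (J : finType) (X : J -> T -> E).
Variable P : J -> probability E R.
Hypothesis mX : forall i, measurable_fun setT (X i).
Hypothesis lawX : forall i B, measurable B -> Pr (X i @^-1` B) = P i B.
Hypothesis indX : mutually_independent Pr X.

(* Generates the sigma-algebra of the variables other than [X s]. *)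
Definition others (s : J) : set (set T) :=
  [set S | exists2 A : J -> set E, (forall i, measurable (A i)) &
     S = \bigcap_(i in [set i | i != s]) (X i @^-1` A i)].

Lemma others_measurable s : others s `<=` measurable.
Proof.
move=> _ [A mA ->]; apply: fin_bigcap_measurable => [|i _]; first exact: finite_finset.
by rewrite -[X in measurable X]setTI; exact: mX.
Qed.

Lemma others_setI s : setI_closed (others s).
Proof.
move=> _ _ [A mA ->] [B mB ->]; exists (fun i => A i `&` B i).
  by move=> i; exact: measurableI.
by rewrite -bigcapI.
Qed.

Lemma othersT s : others s setT.
Proof.
exists (fun=> setT) => //; apply/seteqP; split => // t _ i _ //.
Qed.

Lemma others_sub s (S : set (g_sigma_algebraType (others s))) :
  measurable S -> measurable (S : set T).
Proof.
move=> mS; have := smallest_sub (@sigma_algebra_measurable _ T) (@others_measurable s).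
by apply; exact: mS.
Qed.

Lemma measurable_fun_others s u : u != s ->
  measurable_fun setT (X u : g_sigma_algebraType (others s) -> E).
Proof.
move=> us _ B mB; rewrite setTI; apply: sub_sigma_algebra.
exists (fun i => if i == u then B else setT).
  by move=> i; case: ifP.
apply/seteqP; split => [t Xt i /= _|t /(_ u us)/=]; last by rewrite eqxx.
by case: eqP => [->|].
Qed.

(** Both sides are finite measures in S. They agree on the pi-system [others s] by mutual
    independence, hence on the sigma-algebra that it generates. *)
Lemma independent_of_others s B S : measurable B -> <<s others s >> S ->
  Pr (X s @^-1` B `&` S) = P s B * Pr S.
Proof.
move=> mB oS.
have mXB : measurable (X s @^-1` B) by rewrite -[X in measurable X]setTI; exact: mX.
pose m1 := mrestr Pr mXB.
have PB0 : (0 <= fine (P s B))%R by rewrite fine_ge0.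
pose m2 := mscale (NngNum PB0) Pr.
suff : m1 S = m2 S.
  by rewrite /m1 /m2 /mrestr /mscale/= fineK ?fin_num_measure// setIC.
apply: (@g_sigma_algebra_measure_unique _ R T (others s) _ (fun=> setT)) => //.
- exact: others_measurable.
- by move=> _; exact: othersT.
- by rewrite bigcup_const.
- exact: others_setI.
- move=> _ [A mA ->]; rewrite /m1 /m2/= /mrestr /mscale/= fineK ?fin_num_measure//.
  rewrite [X in Pr X](_ : _ =
    \bigcap_i (X i @^-1` (if i == s then B else A i))); last first.
    apply/seteqP; split => [t [tA tB] i _ /=|t tAB].
      by case: eqP => [->//|/eqP/tA].
    split => [i/= /negbTE si|].
      by have := tAB i I; rewrite si.
    by have := tAB s I; rewrite eqxx.
  (* A generator of [others s] leaves the coordinate s free; putting [setT] there gives a rectangle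
     whose factor at s is 1. *)
  rewrite [X in _ * Pr X](_ : _ =
    \bigcap_i (X i @^-1` (if i == s then setT else A i))); last first.
    apply/seteqP; split => [t tA i _ /=|t tAB i/= /negbTE si].
      by case: eqP => [->//|/eqP/tA].
    by have := tAB i I; rewrite si.
  rewrite !indX; last 2 first.
    by move=> i; case: ifP.
    by move=> i; case: ifP.
  rewrite (bigD1 s)//= [in RHS](bigD1 s)//= eqxx preimage_setT probability_setT.
  rewrite mul1e lawX//; congr (_ * _).
  by apply: eq_bigr => i /negbTE ->.
- by move=> _; rewrite /m1/= /mrestr setTI (le_lt_trans (probability_le1 _ _))// ltry.
Qed.

(** The identity onto the coarser sigma-algebra; its distribution is the restriction of [Pr] to the
    events determined by the other variables. *)
Definition id_others s (t : T) : g_sigma_algebraType (others s) := t.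

Lemma measurable_id_others s : measurable_fun setT (@id_others s).
Proof. by move=> _ B mB; rewrite setTI; exact: (@others_sub s B mB). Qed.

HB.instance Definition _ s :=
  isMeasurableFun.Build _ _ _ _ (@id_others s) (@measurable_id_others s).

Definition graph s (t : T) : E * g_sigma_algebraType (others s) := (X s t, t).

Lemma measurable_graph s : measurable_fun setT (@graph s).
Proof.
by apply: measurable_fun_pair; [exact: mX|exact: measurable_id_others].
Qed.

HB.instance Definition _ s :=
  isMeasurableFun.Build _ _ _ _ (@graph s) (@measurable_graph s).

(** On rectangles this is the independence of [X s] from the others, and rectangles determine the
    product measure. *)
Lemma distribution_graph s A : measurable A ->
  (P s \x distribution Pr (@id_others s)) A = distribution Pr (@graph s) A.
Proof.
move=> mA; apply: product_measure_unique => // B S mB mS.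
exact: (independent_of_others mB).
Qed.

(** Fubini on the product law, with [X s] integrated first and everything else frozen in t. It
    stands in for conditioning on the other variables. *)
Lemma integral_centered s (F : E * g_sigma_algebraType (others s) -> R) :
  measurable_fun setT F ->
  Pr.-integrable setT (fun t => (F (X s t, t))%:E) ->
  (forall t, \int[P s]_x (F (x, t))%:E = 0) ->
  \int[Pr]_t (F (X s t, t))%:E = 0.
Proof.
move=> mF iF F0.
have mF' : measurable_fun setT (EFin \o F) by exact/measurable_EFinP.
have iF' : (distribution Pr (@graph s)).-integrable setT (EFin \o F).
  by apply: integrable_pushforward => //; rewrite preimage_setT.
transitivity (\int[distribution Pr (@graph s)]_z (F z)%:E).
  rewrite (@integral_pushforward _ _ _ _ _ (@graph s) (@measurable_graph s) Pr setT (EFin \o F))//.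
transitivity (\int[P s \x distribution Pr (@id_others s)]_z (F z)%:E).
  by apply: eq_measure_integral => A mA _; exact/esym/distribution_graph.
rewrite -(@integral21_prod_meas1 _ _ _ _ _ _ _ (EFin \o F)); last first.
  apply/integrableP; split => //.
  case/integrableP : iF' => _; apply: le_lt_trans.
  rewrite le_eqVlt; apply/orP; left; apply/eqP.
  by apply: eq_measure_integral => A mA _; exact: distribution_graph.
rewrite /fubini_G/=.
by rewrite integral0_eq// => t _; exact: F0.
Qed.

End independence.

(** * Hoeffding decomposition of a quadratic form in independent variables *)

Section hoeffding.
Local Open Scope ereal_scope.
Context (R : realType) d (T : measurableType d) (Pr : probability T R).
Context d' (E : measurableType d') (J : finType) (X : J -> T -> E).
Variable P : J -> probability E R.
Hypothesis mX : forall i, measurable_fun setT (X i).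
Hypothesis lawX : forall i B, measurable B -> Pr (X i @^-1` B) = P i B.
Hypothesis indX : mutually_independent Pr X.
Variables (K : E -> E -> R) (beta : R).
Hypothesis mK : measurable_fun setT (fun z : E * E => K z.1 z.2).
Hypothesis K0 : forall x y, (0 <= K x y)%R.
Hypothesis Ksym : forall x y, K x y = K y x.
Hypothesis Kfin : forall s y, \int[P s]_x (K x y)%:E < +oo.
Hypothesis K2 : forall s t,
  \int[P t]_y \int[P s]_x (K x y ^+ 2)%:E <= beta%:E.

Lemma ge0_integral_law s (f : E -> \bar R) : measurable_fun setT f ->
  (forall x, 0 <= f x) -> \int[Pr]_t f (X s t) = \int[P s]_x f x.
Proof. by move=> mf f0; exact: (ge0_integral_image (mX s) (@lawX s) mf f0). Qed.

Lemma ge0_integral_law2 s u (f : E * E -> \bar R) : u != s ->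
  measurable_fun setT f -> (forall x, 0 <= f x) ->
  \int[Pr]_t f (X s t, X u t) = \int[P u]_y \int[P s]_x f (x, y).
Proof.
move=> us mf f0.
have mXX : measurable_fun setT (fun t => (X s t, X u t)).
  by apply: measurable_fun_pair; exact: mX.
pose XX := HB.pack_for {mfun T >-> (E * E)%type} (fun t => (X s t, X u t))
  (isMeasurableFun.Build _ _ _ _ _ mXX).
transitivity (\int[distribution Pr XX]_x f x).
  by rewrite ge0_integral_pushforward// preimage_setT.
transitivity (\int[P s \x P u]_z f z).
  apply: eq_measure_integral => A mA _; apply/esym.
  apply: product_measure_unique => // B C mB mC.
  transitivity (P s B * Pr (X u @^-1` C)); last by congr (_ * _); exact: lawX.
  apply: (independent_of_others mX lawX indX mB).
  rewrite -[X in <<s _ >> X]setTI.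
  exact: (measurable_fun_others us measurableT mC).
by rewrite fubini_tonelli2.
Qed.

Definition mean1 s (y : E) : R := fine (\int[P s]_x (K x y)%:E).

Lemma mean1E s y : \int[P s]_x (K x y)%:E = (mean1 s y)%:E.
Proof. by rewrite fineK// ge0_fin_numE// integral_ge0// => x _; rewrite lee_fin. Qed.

Lemma measurable_Kl y : measurable_fun setT (K^~ y).
Proof. exact: (measurableT_comp mK (pair2_measurable y)). Qed.

Lemma measurable_mean1 s : measurable_fun setT (mean1 s).
Proof.
have mKE : measurable_fun setT (EFin \o (fun z : E * E => K z.1 z.2)).
  exact/measurable_EFinP.
have := @measurable_fun_fubini_tonelli_G _ _ _ _ _ (P s) _ mKE.
have K0' (x : E * E) : 0 <= (EFin \o (fun z : E * E => K z.1 z.2)) x.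
  by rewrite lee_fin.
move=> /(_ K0') /= mG; exact: (measurableT_comp (fine_measurable measurableT)).
Qed.

Lemma integrable_Kl s y : (P s).-integrable setT (fun x => (K x y)%:E).
Proof.
apply/integrableP; split; first by apply/measurable_EFinP; exact: measurable_Kl.
by under eq_integral do rewrite gee0_abs ?lee_fin ?K0//; exact: Kfin.
Qed.

Lemma mean1_sqr s t : \int[P t]_y (mean1 s y ^+ 2)%:E <= beta%:E.
Proof.
apply: le_trans (K2 s t); apply: ge0_le_integral => //.
- by move=> y _; rewrite lee_fin sqr_ge0.
- by apply: measurable_sqr; exact: measurable_mean1.
- apply: (@measurable_fun_fubini_tonelli_G _ _ _ _ _ (P s)
    (fun z => (K z.1 z.2 ^+ 2)%:E)); first exact: measurable_sqr.
  by move=> z; rewrite lee_fin sqr_ge0.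
- move=> y _.
  (* Jensen is applied where the inner second moment is finite; where it is infinite the bound is
     trivial. *)
  have [ltoo|] := ltP (\int[P s]_x (K x y ^+ 2)%:E) +oo; last first.
    by rewrite leye_eq => /eqP ->; rewrite leey.
  by apply: integral_sqr_le; split => //; exact: measurable_Kl.
Qed.

Lemma sqr_integrable_mean1 s t : sqr_integrable (P t) (mean1 s).
Proof.
by split; [exact: measurable_mean1|rewrite (le_lt_trans (mean1_sqr s t))// ltry].
Qed.

Definition mean2 s t : R := fine (\int[P t]_y (mean1 s y)%:E).

Lemma mean2E s t : \int[P t]_y (mean1 s y)%:E = (mean2 s t)%:E.
Proof.
rewrite fineK//; apply: (integrable_fin_num _ (sqr_integrable_integrable _)) => //.
exact: sqr_integrable_mean1.
Qed.

Lemma mean2C s t : mean2 s t = mean2 t s.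
Proof.
apply: EFin_inj; rewrite -!mean2E.
under eq_integral do rewrite -mean1E.
under [RHS]eq_integral do rewrite -mean1E.
have mKE : measurable_fun setT (EFin \o (fun z : E * E => K z.1 z.2)).
  exact/measurable_EFinP.
have K0' (x : E * E) : 0 <= (EFin \o (fun z : E * E => K z.1 z.2)) x.
  by rewrite lee_fin.
rewrite -(@fubini_tonelli _ _ _ _ _ (P s) (P t) _ mKE K0') /=.
by apply: eq_integral => x _; apply: eq_integral => y _; rewrite Ksym.
Qed.

Lemma mean2_sqr s t : (mean2 s t ^+ 2 <= beta)%R.
Proof.
rewrite -lee_fin; apply: le_trans (mean1_sqr s t).
by apply: integral_sqr_le; exact: sqr_integrable_mean1.
Qed.

Lemma beta_ge0 (s : J) : (0 <= beta)%R.
Proof. by apply: le_trans (mean2_sqr s s); exact: sqr_ge0. Qed.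

(** The canonical second-order Hoeffding kernel: its mean is zero in x under [P s] and in y under
    [P t]. *)
Definition degenerate s t x y : R := (K x y - mean1 t x - mean1 s y + mean2 s t)%R.

Lemma degenerateC s t x y : degenerate s t x y = degenerate t s y x.
Proof. by rewrite /degenerate mean2C Ksym; ring. Qed.

Lemma integral_degenerate s t y :
  (P s).-integrable setT (fun x => (degenerate s t x y)%:E) /\
  \int[P s]_x (degenerate s t x y)%:E = 0.
Proof.
have i1 := integrable_Kl s y.
have i2 : (P s).-integrable setT (EFin \o mean1 t).
  exact: sqr_integrable_integrable (sqr_integrable_mean1 t s).
have i3 : (P s).-integrable setT (EFin \o (fun=> (mean2 s t - mean1 s y)%R)).
  exact: sqr_integrable_integrable (sqr_integrable_cst _ _).
have i12 : (P s).-integrable setT (fun x => (K x y - mean1 t x)%:E).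
  exact: (integrableB measurableT i1 i2).
have -> : (fun x => (degenerate s t x y)%:E) =
   (fun x => (K x y - mean1 t x)%:E + (mean2 s t - mean1 s y)%:E).
  by apply/funext => x; rewrite -EFinD /degenerate; congr (_%:E); ring.
split; first exact: (integrableD measurableT i12 i3).
rewrite (integralD measurableT i12 i3) integral_probability_cst.
rewrite (integralB_EFin measurableT i1 i2) mean1E mean2E -EFinB -EFinD.
by congr (_%:E); rewrite [mean2 t s]mean2C; ring.
Qed.

Lemma measurable_degenerate s t :
  measurable_fun setT (fun z : E * E => degenerate s t z.1 z.2).
Proof.
apply: measurable_funD => //; apply: measurable_funB; [apply: measurable_funB|] => //.
  exact: (measurableT_comp (measurable_mean1 t)).
exact: (measurableT_comp (measurable_mean1 s)).
Qed.

Lemma measurable_degenerateX s t :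
  measurable_fun setT (fun w => degenerate s t (X s w) (X t w)).
Proof.
apply: (measurableT_comp (measurable_degenerate s t)
  (_ : measurable_fun setT (fun w => (X s w, X t w)))).
by apply: measurable_fun_pair; exact: mX.
Qed.

(** Each of the four terms has second moment at most beta; adding them in two rounds gives 2 (4 beta
    + 4 beta) = 16 beta. *)
Lemma degenerate_sqr s t : t != s ->
  \int[Pr]_w (degenerate s t (X s w) (X t w) ^+ 2)%:E <= (16 * beta)%:E.
Proof.
move=> ts.
have m1 : measurable_fun setT (fun w => K (X s w) (X t w)).
  apply: (measurableT_comp mK (_ : measurable_fun setT (fun w => (X s w, X t w)))).
  by apply: measurable_fun_pair; exact: mX.
have m2 u v : measurable_fun setT (fun w => mean1 u (X v w)).
  exact: measurableT_comp (measurable_mean1 u) (mX v).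
have b1 : \int[Pr]_w (K (X s w) (X t w) ^+ 2)%:E <= beta%:E.
  rewrite (@ge0_integral_law2 s t (fun z => (K z.1 z.2 ^+ 2)%:E))//.
    exact: measurable_sqr.
  by move=> z; rewrite lee_fin sqr_ge0.
have b2 u v : \int[Pr]_w ((- mean1 u (X v w)) ^+ 2)%:E <= beta%:E.
  under eq_integral do rewrite sqrrN.
  rewrite (@ge0_integral_law v (fun x => (mean1 u x ^+ 2)%:E)).
  - exact: mean1_sqr.
  - by apply: measurable_sqr; exact: measurable_mean1.
  - by move=> z; rewrite lee_fin sqr_ge0.
have b3 : \int[Pr]_w (mean2 s t ^+ 2)%:E <= beta%:E.
  by rewrite integral_probability_cst lee_fin mean2_sqr.
have comb (f g : T -> R) a b : measurable_fun setT f -> measurable_fun setT g ->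
   \int[Pr]_w (f w ^+ 2)%:E <= a%:E -> \int[Pr]_w (g w ^+ 2)%:E <= b%:E ->
   \int[Pr]_w ((f w + g w) ^+ 2)%:E <= (2 * (a + b))%:E.
  move=> mf mg fa gb; apply: le_trans (sqr_integral_addn_le Pr mf mg) _.
  by rewrite EFinM lee_pmul2l// [leRHS]EFinD; exact: leeD.
pose f1 w := (K (X s w) (X t w) + - mean1 t (X s w))%R.
pose f2 w := (- mean1 s (X t w) + mean2 s t)%R.
have mf1 : measurable_fun setT f1 by apply: measurable_funB.
have mf2 : measurable_fun setT f2.
  by apply: measurable_funD => //; exact: measurableT_comp.
have h1 : \int[Pr]_w (f1 w ^+ 2)%:E <= (2 * (beta + beta))%:E.
  by apply: comb => //; exact: measurableT_comp.
have h2 : \int[Pr]_w (f2 w ^+ 2)%:E <= (2 * (beta + beta))%:E.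
  by apply: comb => //; exact: measurableT_comp.
rewrite [leLHS](_ : _ = \int[Pr]_w ((f1 w + f2 w) ^+ 2)%:E); last first.
  by apply: eq_integral => w _; rewrite /degenerate/= /f1 /f2 addrA.
apply: le_trans (comb _ _ _ _ mf1 mf2 h1 h2) _.
have := beta_ge0 s; rewrite lee_fin; lra.
Qed.

(** W is a function of the variables other than [X s], so integrating [X s] first leaves the zero
    mean of [degenerate] in its first argument. *)
Lemma degenerate_orthogonal s t (W : T -> R) : t != s ->
  measurable_fun setT (W : g_sigma_algebraType (others X s) -> R) ->
  Pr.-integrable setT (fun w => (degenerate s t (X s w) (X t w) * W w)%:E) ->
  \int[Pr]_w (degenerate s t (X s w) (X t w) * W w)%:E = 0.
Proof.
move=> ts mW iW.
pose F (z : E * g_sigma_algebraType (others X s)) : R :=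
  (degenerate s t z.1 (X t z.2) * W z.2)%R.
apply: (@integral_centered _ _ _ _ _ _ _ _ _ mX lawX indX s F) => //.
  have mXt : measurable_fun setT (fun z : E * g_sigma_algebraType (others X s) =>
      (z.1, X t z.2)).
    apply: measurable_fun_pair => //.
    exact: (measurableT_comp (measurable_fun_others (X := X) ts)).
  apply: measurable_funM; last exact: (measurableT_comp mW).
  exact: (measurableT_comp (measurable_degenerate s t) mXt).
move=> w; rewrite /F/=; under eq_integral do rewrite EFinM.
have [i0 e0] := integral_degenerate s t (X t w).
by rewrite integralZr// e0 mul0e.
Qed.

Variable c : J -> J -> R.
Hypothesis cC : forall s t, c s t = c t s.
Hypothesis css : forall s, c s s = 0%R.

Definition quadratic_form w : R := (\sum_s \sum_t c s t * K (X s w) (X t w))%R.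

Definition projection s x : R := (\sum_t c s t * mean1 t x)%R.

Definition projection_mean s : R := fine (\int[P s]_x (projection s x)%:E).

(** The factor 2 appears because the one-variable terms of (s, t) and (t, s) give equal sums when c
    is symmetric. *)
Definition linear_part s w : R := (2 * (projection s (X s w) - projection_mean s))%R.

Definition degenerate_part (p : J * J) w : R :=
  (c p.1 p.2 * degenerate p.1 p.2 (X p.1 w) (X p.2 w))%R.

(** With symmetric c vanishing on the diagonal this is the mean of the quadratic form, in a shape
    that makes the decomposition an algebraic identity. *)
Definition center : R :=
  (\sum_s 2 * projection_mean s - \sum_s \sum_t c s t * mean2 s t)%R.

Lemma quadratic_formE w : (quadratic_form w - center =
  \sum_s linear_part s w + \sum_p degenerate_part p w)%R.
Proof.
rewrite -(pair_bigA _ (fun s t => degenerate_part (s, t) w))/=.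
rewrite /degenerate_part/= /degenerate.
rewrite [X in (_ = _ + X)%R](_ : _ = quadratic_form w
   - \sum_s projection s (X s w) - \sum_s \sum_t c s t * mean1 s (X t w)
   + \sum_s \sum_t c s t * mean2 s t)%R; last first.
  rewrite /quadratic_form /projection -!sumrB -big_split/=.
  apply: eq_bigr => s _; rewrite -!sumrB -big_split/=.
  by apply: eq_bigr => t _; ring.
rewrite [X in (_ = _ + (_ - X + _))%R](_ : _ = \sum_s projection s (X s w))%R; last first.
  rewrite exchange_big/=; apply: eq_bigr => s _; apply: eq_bigr => t _.
  by rewrite cC.
rewrite /linear_part /center -!mulr_sumr sumrB.
by ring.
Qed.

Lemma sqr_integrable_projection s t : sqr_integrable (P t) (projection s).
Proof.
apply: sqr_integrable_sum => u; apply: sqr_integrableZ.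
exact: sqr_integrable_mean1.
Qed.

Lemma sqr_integrable_law s (f : E -> R) : sqr_integrable (P s) f ->
  sqr_integrable Pr (fun w => f (X s w)).
Proof.
move=> [mf f2]; split; first exact: measurableT_comp.
rewrite (@ge0_integral_law s (fun x => (f x ^+ 2)%:E))//.
  exact: measurable_sqr.
by move=> z; rewrite lee_fin sqr_ge0.
Qed.

Lemma sqr_integrable_linear_part s : sqr_integrable Pr (linear_part s).
Proof.
apply: sqr_integrableZ; apply: sqr_integrableD; last exact: sqr_integrable_cst.
by apply: sqr_integrable_law; exact: sqr_integrable_projection.
Qed.

Lemma linear_part_orthogonal s u : u != s ->
  \int[Pr]_w (linear_part s w * linear_part u w)%:E = 0.
Proof.
move=> us.
have mproj v : measurable_fun setT (projection v).
  by have [] := sqr_integrable_projection v v.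
have iW : Pr.-integrable setT (fun w => (linear_part s w * linear_part u w)%:E).
  by apply: sqr_integrableM; exact: sqr_integrable_linear_part.
pose F (z : E * g_sigma_algebraType (others X s)) : R :=
  (2 * (projection s z.1 - projection_mean s) * linear_part u z.2)%R.
have mF : measurable_fun setT F.
  apply: measurable_funM.
    apply: measurable_funM => //; apply: measurable_funB => //.
    exact: (measurableT_comp (mproj s)).
  apply: measurable_funM => //; apply: measurable_funB => //.
  apply: (measurableT_comp (mproj u)).
  exact: (measurableT_comp (measurable_fun_others (X := X) us)).
apply: (@integral_centered _ _ _ _ _ _ _ _ _ mX lawX indX s F mF iW).
move=> w; rewrite /F/=.
under eq_integral do rewrite mulrAC [(2 * _)%R]mulrC EFinM.
have ip : (P s).-integrable setT (EFin \o projection s).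
  exact: sqr_integrable_integrable (sqr_integrable_projection s s).
have ic : (P s).-integrable setT (EFin \o (fun=> projection_mean s)).
  exact: sqr_integrable_integrable (sqr_integrable_cst _ _).
rewrite integralZl//; last exact: (integrableB measurableT ip ic).
rewrite (integralB_EFin measurableT ip ic)/= integral_probability_cst.
rewrite /projection_mean fineK; last exact: (integrable_fin_num measurableT ip).
by rewrite subee ?mule0//; exact: (integrable_fin_num measurableT ip).
Qed.

Lemma linear_part_sqr s : \int[Pr]_w (linear_part s w ^+ 2)%:E
  <= 16%:E * \int[P s]_x (projection s x ^+ 2)%:E.
Proof.
have p2 := sqr_integrable_projection s s; have [mp _] := p2.
have mpm : measurable_fun setT (fun x => projection s x - projection_mean s)%R.
  exact: measurable_funB.
rewrite /linear_part sqr_integralZ; last exact: (measurableT_comp mpm).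
rewrite (@ge0_integral_law s (fun x => ((projection s x - projection_mean s) ^+ 2)%:E));
  last 2 first.
- exact: measurable_sqr.
- by move=> z; rewrite lee_fin sqr_ge0.
apply: (@le_trans _ _ ((2 ^+ 2)%:E * (4%:E * \int[P s]_x (projection s x ^+ 2)%:E))).
  by rewrite lee_pmul2l ?lte_fin//; exact: sqr_integral_centered_le.
rewrite muleA -EFinM; apply: lee_wpmul2r.
  by apply: integral_ge0 => x _; rewrite lee_fin sqr_ge0.
by rewrite lee_fin; lra.
Qed.

Lemma degenerate_part_sqr p : \int[Pr]_w (degenerate_part p w ^+ 2)%:E
  <= (c p.1 p.2 ^+ 2 * (16 * beta))%:E.
Proof.
rewrite /degenerate_part sqr_integralZ; last exact: measurable_degenerateX.
have [->|ts] := eqVneq p.2 p.1; first by rewrite css expr0n/= mul0e mul0r.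
rewrite [leRHS]EFinM; apply: lee_wpmul2l; first by rewrite lee_fin sqr_ge0.
exact: degenerate_sqr.
Qed.

Lemma sqr_integrable_degenerate_part p : sqr_integrable Pr (degenerate_part p).
Proof.
split; first by apply: measurable_funM => //; exact: measurable_degenerateX.
by rewrite (le_lt_trans (degenerate_part_sqr p))// ltry.
Qed.

Lemma measurable_others_degenerate_part s u v : u != s -> v != s ->
  measurable_fun setT
    (degenerate_part (u, v) : g_sigma_algebraType (others X s) -> R).
Proof.
move=> us vs; apply: measurable_funM => //.
have mXX : measurable_fun setT
    (fun w : g_sigma_algebraType (others X s) => (X u w, X v w)).
  apply: measurable_fun_pair; exact: (measurable_fun_others (X := X)).
exact: (measurableT_comp (measurable_degenerate u v) mXX).
Qed.

(** The index s does not occur in q, so the second factor is measurable with respect to the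
    variables other than [X s]. *)
Lemma degenerate_part_orthogonal_new s t q : s != q.1 -> s != q.2 ->
  \int[Pr]_w (degenerate_part (s, t) w * degenerate_part q w)%:E = 0.
Proof.
case: q => u v /= su sv.
have [->|ts] := eqVneq t s.
  by rewrite integral0_eq// => w _; rewrite /degenerate_part/= css !mul0r.
pose W w := (degenerate_part (u, v) w * c s t)%R.
have WE w : (degenerate_part (s, t) w * degenerate_part (u, v) w =
    degenerate s t (X s w) (X t w) * W w)%R by rewrite /W /degenerate_part/=; ring.
under eq_integral do rewrite WE.
apply: degenerate_orthogonal => //.
  apply: measurable_funM => //.
  by apply: measurable_others_degenerate_part; rewrite eq_sym.
have := sqr_integrableM (sqr_integrable_degenerate_part (s, t))
  (sqr_integrable_degenerate_part (u, v)).
by apply: eq_integrable => // w _; rewrite WE.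
Qed.

(** Two distinct off-diagonal pairs that are not swaps of each other leave some index of p outside
    q; if it is the second one, symmetry moves it to the front. A pair and its swap give the same
    function, hence the exclusion and the involution used in the second moment bound. *)
Lemma degenerate_part_orthogonal (p q : J * J) : q != p -> q != (p.2, p.1) ->
  \int[Pr]_w (degenerate_part p w * degenerate_part q w)%:E = 0.
Proof.
case: p q => s t [u v] /= qp qp'.
have [->|ts] := eqVneq t s.
  by rewrite integral0_eq// => w _; rewrite /degenerate_part/= css !mul0r.
have [->|vu] := eqVneq v u.
  by rewrite integral0_eq// => w _; rewrite /degenerate_part/= css !mul0r mulr0.
have [/andP[su sv]|s_in] := boolP ((s != u) && (s != v)).
  exact: degenerate_part_orthogonal_new.
have swap w : degenerate_part (s, t) w = degenerate_part (t, s) w.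
  by rewrite /degenerate_part/= cC degenerateC.
under eq_integral do rewrite swap.
have [/andP[tu tv]|t_in] := boolP ((t != u) && (t != v)).
  exact: degenerate_part_orthogonal_new.
exfalso; move: s_in t_in; rewrite !negb_and !negbK.
move=> /orP[/eqP su|/eqP sv] /orP[/eqP tu|/eqP tv].
- by move: ts; rewrite su tu eqxx.
- by move: qp; rewrite su tv eqxx.
- by move: qp'; rewrite sv tu eqxx.
- by move: ts; rewrite sv tv eqxx.
Qed.

Lemma sqr_integrable_quadratic_form : sqr_integrable Pr quadratic_form.
Proof.
have -> : quadratic_form = (fun w => (\sum_s linear_part s w +
    \sum_p degenerate_part p w) + center)%R.
  by apply/funext => w; rewrite -quadratic_formE subrK.
apply: sqr_integrableD; last exact: sqr_integrable_cst.
apply: sqr_integrableD.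
  by apply: sqr_integrable_sum => s; exact: sqr_integrable_linear_part.
by apply: sqr_integrable_sum => p; exact: sqr_integrable_degenerate_part.
Qed.

(** In both terms 256 is the product of 4 from [variance_le], 2 for separating the two parts, 2 from
    [second_moment_sum_le] and 16 from the bound on each summand. *)
Theorem variance_quadratic_form_le : variance Pr quadratic_form <=
  (256%:E * \sum_s \int[P s]_x (projection s x ^+ 2)%:E
    + (256 * beta * \sum_s \sum_t c s t ^+ 2)%:E).
Proof.
apply: le_trans (variance_le center sqr_integrable_quadratic_form) _.
have [mL _] : sqr_integrable Pr (fun w => \sum_s linear_part s w)%R.
  by apply: sqr_integrable_sum => s; exact: sqr_integrable_linear_part.
have [mD _] : sqr_integrable Pr (fun w => \sum_p degenerate_part p w)%R.
  by apply: sqr_integrable_sum => p; exact: sqr_integrable_degenerate_part.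
under eq_integral do rewrite quadratic_formE.
have L2 : \int[Pr]_w ((\sum_s linear_part s w) ^+ 2)%:E
    <= 2%:E * \sum_s \int[Pr]_w (linear_part s w ^+ 2)%:E.
  apply: (@second_moment_sum_le _ _ _ _ _ id) => //.
  - by move=> s; have [] := sqr_integrable_linear_part s.
  - by move=> s; have [] := sqr_integrable_linear_part s.
  - by move=> s u us _; exact: linear_part_orthogonal.
have D2 : \int[Pr]_w ((\sum_p degenerate_part p w) ^+ 2)%:E
    <= 2%:E * \sum_p \int[Pr]_w (degenerate_part p w ^+ 2)%:E.
  apply: (@second_moment_sum_le _ _ _ _ _ (fun p => (p.2, p.1))).
  - by case.
  - by move=> s; have [] := sqr_integrable_degenerate_part s.
  - by move=> s; have [] := sqr_integrable_degenerate_part s.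
  - by move=> p q; exact: degenerate_part_orthogonal.
have S0 : 0 <= \sum_s \int[P s]_x (projection s x ^+ 2)%:E.
  by apply: sume_ge0 => s _; apply: integral_ge0 => x _; rewrite lee_fin sqr_ge0.
have {}L2 : \int[Pr]_w ((\sum_s linear_part s w) ^+ 2)%:E
    <= 32%:E * \sum_s \int[P s]_x (projection s x ^+ 2)%:E.
  apply: le_trans L2 _.
  rewrite (_ : 32%:E = 2%:E * 16%:E); last by rewrite -EFinM; congr (_%:E); ring.
  rewrite -muleA lee_pmul2l// ge0_sume_distrr; last first.
    by move=> s _; apply: integral_ge0 => x _; rewrite lee_fin sqr_ge0.
  by apply: lee_sum => s _; exact: linear_part_sqr.
have {}D2 : \int[Pr]_w ((\sum_p degenerate_part p w) ^+ 2)%:E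
    <= (32 * beta * \sum_s \sum_t c s t ^+ 2)%:E.
  apply: le_trans D2 _.
  apply: (@le_trans _ _ (2%:E * \sum_p (c p.1 p.2 ^+ 2 * (16 * beta))%:E)).
    by rewrite lee_pmul2l//; apply: lee_sum => p _; exact: degenerate_part_sqr.
  rewrite sumEFin -EFinM lee_fin -mulr_suml.
  rewrite -(pair_bigA _ (fun s t => c s t ^+ 2)%R)/=.
  by rewrite le_eqVlt; apply/orP; left; apply/eqP; ring.
apply: (@le_trans _ _ (4%:E * (2%:E *
  (32%:E * \sum_s \int[P s]_x (projection s x ^+ 2)%:E +
    (32 * beta * \sum_s \sum_t c s t ^+ 2)%:E)))).
  rewrite lee_pmul2l//; apply: le_trans (sqr_integral_addn_le Pr mL mD) _.
  by rewrite lee_pmul2l//; exact: leeD.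
rewrite muleA -EFinM muleDr//; last exact: fin_num_adde_defl.
rewrite muleA -!EFinM le_eqVlt; apply/orP; left; apply/eqP.
by congr (_%:E * _ + _%:E); ring.
Qed.

End hoeffding.

(** * Measurability of functionals of a diagram *)

Section plane_measurability.
Variable R : realType.

(** The plane carries the product sigma-algebra, while openness refers to the product topology. An
    open set is the union of the rational boxes that it contains, and these are countably many. *)
Lemma open_measurable_plane (U : set (R * R)) :
  open U -> measurable (U : set (plane R)).
Proof.
move=> oU.
pose box (q : rat * rat * rat) : set (plane R) :=
  [set z | (`|ratr q.1.1 - (z.1 : R)| < ratr q.2) /\
           (`|ratr q.1.2 - (z.2 : R)| < ratr q.2)].
pose Q := [set q : rat * rat * rat | box q `<=` U].
have -> : U = \bigcup_(q in Q) box q.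
  apply/seteqP; split => [[x y] Uxy|z [q Qq]]; last exact: Qq.
  have /nbhs_ballP[e /= e0 eU] := open_nbhs_nbhs (conj oU Uxy).
  (* A box of radius r around a rational point within r of (x, y) stays within 2 r < e of (x, y). *)
  have [r /andP[r0 re]] : exists r : rat, (0 < ratr r :> R) && (ratr r < e / 2 :> R).
    have e20 : 0 < e / 2 by rewrite divr_gt0.
    have [r /itvP rI] := rat_in_itvoo e20.
    by exists r; rewrite !rI.
  have near_rat (u : R) : exists q : rat, `|ratr q - u| < ratr r :> R.
    have [|q] := @rat_in_itvoo R (u - ratr r) (u + ratr r).
      by rewrite ltrD2l gtrN.
    by rewrite in_itv/= => qI; exists q; rewrite ltr_distl.
  have [qx hx] := near_rat x; have [qy hy] := near_rat y.
  exists (qx, qy, r) => // -[x' y'] [/= hx' hy']; apply: eU; split => /=.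
    rewrite /ball/= (le_lt_trans (ler_distD (ratr qx) _ _))//.
    rewrite (splitr e) ltrD// (lt_trans _ re)//.
    by rewrite distrC.
  rewrite /ball/= (le_lt_trans (ler_distD (ratr qy) _ _))//.
  rewrite (splitr e) ltrD// (lt_trans _ re)//.
  by rewrite distrC.
rewrite bigcup_mkcond; apply: countable_bigcupT_measurable => // q.
case: ifP => // _; rewrite /box.
have mrat (f : plane R -> measurableTypeR R) (a b : R) : measurable_fun setT f ->
    measurable [set z : plane R | `|a - (f z : R)| < b].
  move=> mf; rewrite -[X in measurable X]setTI.
  have -> : [set z : plane R | `|a - (f z : R)| < b] =
      (fun z => `|a - (f z : R)| < b) @^-1` [set true] by [].
  apply: measurable_fun_ltr => //.
  by apply: measurableT_comp => //; exact: measurable_funB.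
by apply: measurableI; apply: mrat.
Qed.

Lemma continuous_measurable_plane (f : R * R -> R) : continuous f ->
  measurable_fun setT (f : plane R -> R).
Proof.
move=> /continuousP cf; apply: (measurability _ (RGenOpens.measurableE R)).
move=> _ [_ [a [b ->] <-]]; rewrite setTI; apply: open_measurable_plane.
exact/cf/interval_open.
Qed.

Lemma measurable_Omega : measurable (Omega : set (plane R)).
Proof.
have -> : (Omega : set (plane R)) =
    (fun z => 0 <= (z.1 : R)) @^-1` [set true] `&`
    (fun z => (z.1 : R) < z.2) @^-1` [set true] by [].
by apply: measurableI; rewrite -[X in measurable X]setTI;
  [apply: measurable_fun_ler|apply: measurable_fun_ltr].
Qed.

Lemma measurable_OmegaM (M : R) : measurable (OmegaM M).
Proof.
have -> : OmegaM M = Omega `&` (fun z : plane R => (z.2 : R) < M) @^-1` [set true] by [].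
apply: measurableI; first exact: measurable_Omega.
by rewrite -[X in measurable X]setTI; apply: measurable_fun_ltr.
Qed.

(* Unlike Omega, these sets stay away from the diagonal. *)
Definition Omega_layer (n : nat) : set (plane R) :=
  [set z | [/\ 0 <= (z.1 : R), (z.1 : R) + n.+1%:R^-1 <= z.2 & (z.2 : R) <= n.+1%:R] ].

Lemma measurable_Omega_layer n : measurable (Omega_layer n).
Proof.
have -> : Omega_layer n =
    ((fun z => 0 <= (z.1 : R)) @^-1` [set true] `&`
    (fun z => (z.1 : R) + n.+1%:R^-1 <= z.2) @^-1` [set true]) `&`
    (fun z => (z.2 : R) <= n.+1%:R) @^-1` [set true].
  by apply/seteqP; split => z; [case|case=> -[]].
apply: measurableI; [apply: measurableI|]; rewrite -[X in measurable X]setTI;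
  apply: measurable_fun_ler => //.
exact: measurable_funD.
Qed.

Lemma compact_Omega_layer n : @compact (R * R)%type (Omega_layer n).
Proof.
pose S : set R := `[0, n.+1%:R]%classic.
apply: (@subclosed_compact (R * R)%type (Omega_layer n) (S `*` S)).
- have -> : Omega_layer n =
      (fst @^-1` [set x : R | 0 <= x] `&`
      (fun z => z.2 - z.1) @^-1` [set x : R | n.+1%:R^-1 <= x]) `&`
      snd @^-1` [set x : R | x <= n.+1%:R] :> set (R * R).
    apply/seteqP; split => z /=; rewrite lerBrDl; first by case.
    by case=> -[].
  apply: closedI; [apply: closedI|].
  + by apply: preimage_closed; [move=> z _; exact: cvg_fst|exact: closed_ge].
  + apply: preimage_closed; last exact: closed_ge.
    by move=> z _; apply: cvgB; [exact: cvg_snd|exact: cvg_fst].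
  + by apply: preimage_closed; [move=> z _; exact: cvg_snd|exact: closed_le].
- by apply: compact_setX; exact: segment_compact.
- move=> z [z0 z12 z2].
  have zz : (z.1 : R) <= z.2 by apply: le_trans z12; rewrite lerDl invr_ge0.
  split; rewrite /S/= in_itv/=; apply/andP; split => //.
    exact: le_trans zz z2.
  exact: le_trans z0 zz.
Qed.

Lemma Omega_layer_sub n : Omega_layer n `<=` Omega.
Proof.
move=> z [z0 z12 _]; split => //; apply: lt_le_trans z12.
by rewrite ltrDl invr_gt0.
Qed.

Lemma bigcup_Omega_layer : \bigcup_n Omega_layer n = Omega.
Proof.
apply/seteqP; split => [z [n _]|z [z0 z12]]; first exact: Omega_layer_sub.
have d0 : 0 < (z.2 : R) - z.1 by rewrite subr_gt0.
pose n := maxn (Num.bound ((z.2 : R) - z.1)^-1) (Num.bound (z.2 : R)).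
have hn m : (m <= n)%N -> m%:R <= n.+1%:R :> R by move=> mn; rewrite ler_nat leqW.
exists n => //; split => //.
- rewrite -lerBrDl invf_ple// ?posrE ?ltr0n//.
  apply: le_trans (ltW (archi_boundP _)) (hn _ (leq_maxl _ _)).
  by rewrite invr_ge0 ltW.
- apply: le_trans (ltW (archi_boundP _)) (hn _ (leq_maxr _ _)).
  by apply: le_trans z0 (ltW z12).
Qed.

Lemma nondecreasing_Omega_layer : nondecreasing_seq Omega_layer.
Proof.
move=> m n mn; apply/subsetPset => z [z0 z12 z2]; split => //.
  apply: le_trans z12; rewrite lerD2l lef_pV2// ?posrE ?ltr0n// ler_nat//.
by apply: le_trans z2 _; rewrite ler_nat.
Qed.

(** The sigma-algebra is generated by evaluations on relatively compact sets only. A diagram does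
    not charge the complement of [Omega], so its value on A is the limit of its values on the
    intersections of A with the layers. *)
Lemma measurable_pd_eval (A : set (plane R)) : measurable A ->
  measurable_fun setT (fun D : PD R => pd_eval D A).
Proof.
move=> mA.
have mAn n : measurable (A `&` Omega_layer n).
  by apply: measurableI => //; exact: measurable_Omega_layer.
apply: (emeasurable_fun_cvg (fun n (D : PD R) => pd_eval D (A `&` Omega_layer n))).
  move=> n _ B mB; rewrite setTI; apply: sub_sigma_algebra.
  exists (A `&` Omega_layer n), B; split => //.
  exists (Omega_layer n); split; [exact: compact_Omega_layer| |].
    exact: Omega_layer_sub.
  exact: subIsetr.
move=> D _.
have -> : pd_eval D A = pd_eval D (\bigcup_n (A `&` Omega_layer n)).
  rewrite -setI_bigcupr bigcup_Omega_layer.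
  rewrite -(@measureU0 _ _ _ (pd_eval D) (A `&` Omega) (A `&` ~` Omega)).
  - by rewrite -setIUr setUv setIT.
  - by apply: measurableI => //; exact: measurable_Omega.
  - by apply: measurableI => //; apply: measurableC; exact: measurable_Omega.
  - apply: (@subset_measure0 _ _ _ (pd_eval D) _ (~` Omega)) => //.
    + by apply: measurableI => //; apply: measurableC; exact: measurable_Omega.
    + by apply: measurableC; exact: measurable_Omega.
    + exact: pd_support.
apply: nondecreasing_cvg_mu => //.
- exact: bigcup_measurable.
- move=> m n mn; apply/subsetPset; apply: setIS; apply/subsetPset.
  exact: nondecreasing_Omega_layer.
Qed.

End plane_measurability.

(** * Finite diagrams as a measurable family of finite measures *)

Section finite_diagrams.
Local Open Scope ereal_scope.
Variable R : realType.

(* Replaces the diagrams with infinitely many points, a null event, by 0. *)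
Definition pdfin (x : PD R) (A : set (plane R)) : \bar R :=
  if pd_eval x setT < +oo then pd_eval x A else 0.

Let pdfin0 x : pdfin x set0 = 0.
Proof. by rewrite /pdfin; case: ifP => // _; rewrite measure0. Qed.

Let pdfin_ge0 x A : 0 <= pdfin x A.
Proof. by rewrite /pdfin; case: ifP. Qed.

Let pdfin_sigma_additive x : semi_sigma_additive (pdfin x).
Proof.
have [xoo|xoo] := boolP (pd_eval x setT < +oo).
  have -> : pdfin x = pd_eval x by apply/funext => A; rewrite /pdfin xoo.
  exact: measure_semi_sigma_additive.
have -> : pdfin x = cst 0 by apply/funext => A; rewrite /pdfin (negbTE xoo).
move=> F mF tF mUF; by under eq_fun do rewrite big1_eq; exact: cvg_cst.
Qed.

HB.instance Definition _ x :=
  isMeasure.Build _ _ _ (pdfin x) (pdfin0 x) (pdfin_ge0 x) (@pdfin_sigma_additive x).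

Lemma pdfin_fin_num x : fin_num_fun (pdfin x).
Proof.
apply: lty_fin_num_fun; change (pdfin x setT < +oo); rewrite /pdfin.
by case: ifP.
Qed.

HB.instance Definition _ x := Measure_isFinite.Build _ _ _ (pdfin x) (@pdfin_fin_num x).

Lemma pdfinE x : pd_eval x setT < +oo -> pdfin x = pd_eval x.
Proof. by move=> xoo; apply/funext => A; rewrite /pdfin xoo. Qed.

Lemma measurable_pdfin A : measurable A -> measurable_fun setT (pdfin ^~ A).
Proof.
move=> mA; apply: measurable_fun_ifT => //; last exact: measurable_pd_eval.
by apply: measurable_fun_lte => //; exact: measurable_pd_eval.
Qed.

Definition card_pd (x : PD R) : R := fine (pdfin x setT).

Lemma card_pdE x : pdfin x setT = (card_pd x)%:E.
Proof. by rewrite fineK//; exact: pdfin_fin_num. Qed.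

Lemma card_pd_ge0 x : (0 <= card_pd x)%R.
Proof. by rewrite fine_ge0. Qed.

Lemma measurable_card_pd : measurable_fun setT card_pd.
Proof.
apply: (measurableT_comp (fine_measurable measurableT)).
exact: measurable_pdfin.
Qed.

Context d (S : measurableType d) (X : S -> PD R) (mX : measurable_fun setT X).

Let inv_mass_ge0 x : (0 <= (1 + card_pd x)^-1)%R.
Proof. by rewrite invr_ge0 addr_ge0// card_pd_ge0. Qed.

(** A finite kernel must have uniformly bounded mass, but the number of points is unbounded.
    Dividing by 1 + |D| bounds the mass by 1, and the factor is restored after integration. *)
Definition normalized_pd (s : S) : {measure set (plane R) -> \bar R} :=
  mscale (NngNum (inv_mass_ge0 (X s))) (pdfin (X s)).

Let measurable_normalized_pd A : measurable A ->
  measurable_fun setT (normalized_pd ^~ A).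
Proof.
move=> mA; rewrite /normalized_pd/= /mscale/=; apply: emeasurable_funM.
  apply/measurable_EFinP.
  have c0 x : (0 <= 1 + card_pd x)%R by rewrite addr_ge0// card_pd_ge0.
  under eq_fun do rewrite -powR_inv1//.
  apply: (measurableT_comp (measurable_powR _)).
  by apply: measurable_funD => //; exact: measurableT_comp measurable_card_pd mX.
exact: (measurableT_comp (measurable_pdfin mA)).
Qed.

HB.instance Definition _ :=
  isKernel.Build _ _ _ _ _ normalized_pd measurable_normalized_pd.

Let normalized_pd_uub : measure_fam_uub normalized_pd.
Proof.
exists 2%R => s; rewrite /normalized_pd/= /mscale/= card_pdE -EFinM lte_fin.
have c0 := card_pd_ge0 (X s).
rewrite mulrC ltr_pdivrMr; lra.
Qed.

HB.instance Definition _ :=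
  Kernel_isFinite.Build _ _ _ _ _ normalized_pd normalized_pd_uub.

Lemma measurable_integral_pdfin (f : S * plane R -> \bar R) :
  measurable_fun setT f -> (forall z, 0 <= f z) ->
  measurable_fun setT (fun s => \int[pdfin (X s)]_z f (s, z)).
Proof.
move=> mf f0.
have -> : (fun s => \int[pdfin (X s)]_z f (s, z)) =
    (fun s => (1 + card_pd (X s))%:E * \int[normalized_pd s]_z f (s, z)).
  apply/funext => s; rewrite /normalized_pd ge0_integral_mscale//=.
    rewrite muleA -EFinM mulfV ?mul1e//.
    by have := card_pd_ge0 (X s) => c0; apply/eqP; lra.
  exact: (measurableT_comp mf (pair1_measurable s)).
apply: emeasurable_funM; last exact: measurable_fun_integral_finite_kernel.
apply/measurable_EFinP; apply: measurable_funD => //.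
exact: measurableT_comp measurable_card_pd mX.
Qed.

End finite_diagrams.

(** * Campbell's formula for a mean measure with a density *)

Section mean_measure.
Local Open Scope ereal_scope.
Variable R : realType.
Context d (T : measurableType d) (mu : {measure set T -> \bar R}) (E : set T).
Hypothesis mE : measurable E.
Variables (D : T -> PD R) (c : R) (g : plane R -> R).
Hypothesis mD : measurable_fun setT D.
Hypothesis mg : measurable_fun setT g.
Hypothesis g0 : forall z, (0 <= g z)%R.
Hypothesis gOmega : forall z, ~ Omega z -> g z = 0%R.
Hypothesis density_g : forall A, measurable A -> A `<=` Omega ->
  \int[mu]_(t in E) pd_eval (D t) A = c%:E * \int[leb2]_(z in A) (g z)%:E.

Import HBNNSimple.

Lemma measurable_eval_comp A : measurable A ->
  measurable_fun E (fun t => pd_eval (D t) A).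
Proof.
move=> mA; apply: measurable_funTS.
exact: (measurableT_comp (measurable_pd_eval mA)).
Qed.

(** Neither side charges the complement of [Omega], by [pd_support] and [gOmega], so the density
    formula extends to every measurable set. *)
Let mean_indic A : measurable A -> \int[mu]_(t in E) pd_eval (D t) A =
  c%:E * \int[leb2]_(z in A) (g z)%:E.
Proof.
move=> mA; have mO := @measurable_Omega R.
have mOC : measurable (~` Omega : set (plane R)) by exact: measurableC.
have mAOC : measurable (A `&` ~` Omega) by exact: measurableI mA mOC.
have mAO : measurable (A `&` Omega) by exact: measurableI mA mO.
transitivity (\int[mu]_(t in E) pd_eval (D t) (A `&` Omega)).
  apply: eq_integral => t _.
  rewrite -(@measureU0 _ _ _ (pd_eval (D t)) (A `&` Omega) (A `&` ~` Omega)).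
  - by rewrite -setIUr setUv setIT.
  - exact: mAO.
  - exact: mAOC.
  - apply: (@subset_measure0 _ _ _ (pd_eval (D t)) _ (~` Omega)) => //.
    exact: pd_support.
rewrite (density_g mAO (@subIsetr _ _ _)).
congr (_ * _); rewrite [LHS]integral_mkcond [RHS]integral_mkcond.
apply: eq_integral => z _; rewrite !patchE in_setI.
case: (z \in A) => //=; case: ifPn => // zO.
by rewrite gOmega//; move/mem_set; exact/negP.
Qed.

Let mean_nnsfun (f : {nnsfun plane R >-> R}) :
  \int[mu]_(t in E) \int[pd_eval (D t)]_z (f z)%:E =
  c%:E * \int[leb2]_z ((f z)%:E * (g z)%:E).
Proof.
have mf r : measurable (f @^-1` [set r]).
  by rewrite -[X in measurable X]setTI; exact: measurable_funP.
under eq_integral do rewrite integralT_nnsfun sintegralE.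
rewrite ge0_integral_fsum//; last 2 first.
- by move=> r; apply: measurable_funeM; exact: measurable_eval_comp.
- move=> r t _; have [r0|r0] := leP 0%R r; first by rewrite mule_ge0.
  by rewrite preimage_nnfun0// measure0 mule0.
have mg' : measurable_fun setT (EFin \o g) by exact/measurable_EFinP.
transitivity (\sum_(r \in range f) (c%:E * (r%:E * \int[leb2]_(z in f @^-1` [set r]) (g z)%:E))).
  apply: eq_fsbigr => r _; have [r0|r0] := leP 0%R r; last first.
    rewrite preimage_nnfun0//.
    under eq_integral do rewrite measure0 mule0.
    by rewrite integral0 integral_set0 !mule0.
  rewrite ge0_integralZl//; first by rewrite mean_indic// muleCA.
  exact: measurable_eval_comp.
rewrite -ge0_mule_fsumr; last first.
  move=> r; have [r0|r0] := leP 0%R r.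
    by rewrite mule_ge0 ?lee_fin// integral_ge0// => z _; rewrite lee_fin.
  by rewrite preimage_nnfun0// integral_set0 mule0.
congr (_ * _).
transitivity (\int[leb2]_z (\sum_(r \in range f)
    (r%:E * ((EFin \o g) \_ (f @^-1` [set r])) z))).
  rewrite ge0_integral_fsum//; last 2 first.
  - move=> r; apply: measurable_funeM.
    by apply/(measurable_restrictT _ _).1 => //; exact: measurable_funTS.
  - move=> r z _; rewrite patchE; case: ifPn => [/set_mem /= <-|_]; last by rewrite mule0.
    by rewrite mule_ge0// lee_fin.
  apply: eq_fsbigr => r _; have [r0|r0] := leP 0%R r; last first.
    rewrite preimage_nnfun0// integral_set0 mule0.
    by under eq_integral do rewrite patch_set0 mule0; rewrite integral0.
  rewrite ge0_integralZl//.
  - by rewrite [in LHS]integral_mkcond.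
  - by apply/(measurable_restrictT _ _).1 => //; exact: measurable_funTS.
  - by move=> z _; apply: erestrict_ge0 => z' _; rewrite lee_fin.
apply: eq_integral => z _.
rewrite (fsbigD1 (f z))//=.
rewrite patchE mem_set//= fsbig1 ?adde0// => r [/= _ rfz].
by rewrite patchE memNset ?mule0// => /= /esym.
by exists z.
Qed.

(** Campbell's formula passes from sets to simple functions and then to monotone limits. E and c
    cover both uses: the event Z = l with its probability, and the whole space with c = 1. *)
Lemma integral_mean_measure (f : plane R -> \bar R) :
  measurable_fun setT f -> (forall z, 0 <= f z) ->
  measurable_fun E (fun t => \int[pd_eval (D t)]_z f z) /\
  \int[mu]_(t in E) \int[pd_eval (D t)]_z f z =
  c%:E * \int[leb2]_z (f z * (g z)%:E).
Proof.
move=> mf f0; pose f_ := nnsfun_approx measurableT mf.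
have f_f z : (f_ n z)%:E @[n --> \oo] --> f z by exact: cvg_nnsfun_approx.
have ndf m n : (m <= n)%N -> forall z, ((f_ m z)%:E <= (f_ n z)%:E).
  by move=> mn z; rewrite lee_fin; exact/lefP/nd_nnsfun_approx.
have mfn n : measurable_fun setT (fun z => (f_ n z)%:E) by exact/measurable_EFinP.
have mI n : measurable_fun E (fun t => \int[pd_eval (D t)]_z (f_ n z)%:E).
  under eq_fun do rewrite integralT_nnsfun sintegralE.
  apply: emeasurable_fsum => // r; apply: measurable_funeM.
  apply: measurable_eval_comp.
  by rewrite -[X in measurable X]setTI; exact: measurable_funP.
have cI t : (\int[pd_eval (D t)]_z (f_ n z)%:E) @[n --> \oo]
    --> \int[pd_eval (D t)]_z f z.
  have -> : \int[pd_eval (D t)]_z f z =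
      \int[pd_eval (D t)]_z limn (fun n => (f_ n z)%:E).
    by apply: eq_integral => z _; apply/esym/cvg_lim.
  apply: cvg_monotone_convergence => //.
  - by move=> n z _; rewrite lee_fin.
  - by move=> z _ m n mn; exact: ndf.
have mlim : measurable_fun E (fun t => \int[pd_eval (D t)]_z f z).
  exact: (emeasurable_fun_cvg (fun n t => \int[pd_eval (D t)]_z (f_ n z)%:E)).
split => //.
transitivity (limn (fun n => \int[mu]_(t in E) \int[pd_eval (D t)]_z (f_ n z)%:E)).
  rewrite -monotone_convergence//.
  - by apply: eq_integral => t _; apply/esym/cvg_lim.
  - by move=> n t _; apply: integral_ge0 => z _; rewrite lee_fin.
  - move=> t _ m n mn; apply: ge0_le_integral => //.
    + by move=> z _; rewrite lee_fin.
    + by move=> z _; exact: ndf.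
rewrite [X in limn X](_ : _ =
    (fun n => c%:E * \int[leb2]_z ((f_ n z)%:E * (g z)%:E))); last first.
  by apply/funext => n; exact: mean_nnsfun.
have mfg n : measurable_fun setT (fun z => (f_ n z)%:E * (g z)%:E).
  by apply: emeasurable_funM => //; exact/measurable_EFinP.
have ndI : {homo (fun n => \int[leb2]_z ((f_ n z)%:E * (g z)%:E)) :
    m n / (m <= n)%N >-> m <= n}.
  move=> m n mn; apply: ge0_le_integral => //.
  - by move=> z _; rewrite mule_ge0 ?lee_fin.
  - by move=> z _; apply: lee_wpmul2r; [rewrite lee_fin|exact: ndf].
rewrite limeMl//; last exact: ereal_nondecreasing_is_cvgn.
congr (_ * _); rewrite -monotone_convergence//.
- apply: eq_integral => z _; apply/cvg_lim => //.
  by apply: cvgeZr => //; exact: f_f.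
- by move=> n z _; rewrite mule_ge0 ?lee_fin.
- by move=> z _ m n mn; apply: lee_wpmul2r; [rewrite lee_fin|exact: ndf].
Qed.

End mean_measure.

(** * Second moments of diagrams *)

Section diagram_moments.
Local Open Scope ereal_scope.
Variables (R : realType) (F : fieldType) (M N : R) (w : plane R -> R).
Hypothesis N0 : (0 < N)%R.
Hypothesis mw : measurable_fun setT w.
Variable P : probability (PD R) R.
Hypothesis PP : classP F M N w P.

(** Outside [OmegaM M] the extension of w has no prescribed sign. The truncation inherits the sign
    and the upper bound that hold on [OmegaM M], and diagrams almost surely have no point
    elsewhere. *)
Definition trunc_weight (z : plane R) : R := (w z * \1_(OmegaM M) z)%R.

Lemma measurable_trunc_weight : measurable_fun setT trunc_weight.
Proof.
apply: measurable_funM => //; apply: measurable_indic.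
exact: measurable_OmegaM.
Qed.

Definition regular_pd : set (PD R) :=
  [set x | pd_eval x setT < +oo /\ pd_eval x (~` OmegaM M) = 0].

Lemma measurable_regular_pd : measurable regular_pd.
Proof.
have -> : regular_pd =
    (fun x : PD R => pd_eval x setT < +oo) @^-1` [set true] `&`
    (fun x : PD R => pd_eval x (~` OmegaM M)) @^-1` [set 0] by [].
apply: measurableI; rewrite -[X in measurable X]setTI.
  by apply: measurable_fun_lte => //; exact: measurable_pd_eval.
by apply: measurable_pd_eval => //; apply: measurableC; exact: measurable_OmegaM.
Qed.

(** The number of points is almost surely at most the real number [h (Z t)], hence finite, and no
    point leaves [OmegaM M]; both facts pass from the underlying probability space to the law. *)
Lemma classP_regular : P (~` regular_pd) = 0.
Proof.
case: PP => d [T [Pr [D [[mD lawD] _ DM [Z [h [p_ [_ Dh _ _]]]]]]]].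
rewrite -lawD; last by apply: measurableC; exact: measurable_regular_pd.
have : {ae Pr, forall t, regular_pd (D t)}.
  by apply: filterS2 DM Dh => t DtM Dth; split => //; apply: le_lt_trans Dth (ltry _).
case=> A [mA A0 sA]; apply: (subset_measure0 _ mA _ A0) => //.
rewrite -[X in measurable X]setTI; apply: mD => //.
by apply: measurableC; exact: measurable_regular_pd.
Qed.

(** On the event Z = l the cardinality is at most [h l]; Campbell's formula then gives the integral
    of w^2 p_l g, at most the essential norm of w^2 p_l times the integral of g. The sum over l is
    the series bounded by N. *)
Lemma classP_moment (g : plane R -> \bar R) :
  measurable_fun setT g -> (forall z, 0 <= g z) ->
  \int[P]_x ((card_pd x)%:E * \int[pdfin x]_z ((trunc_weight z ^+ 2)%:E * g z))
    <= N%:E * \int[leb2]_(z in OmegaM M) g z.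
Proof.
move=> mg g0.
have mO := @measurable_OmegaM R M.
have [Goo|] := ltP (\int[leb2]_(z in OmegaM M) g z) +oo; last first.
  by rewrite leye_eq => /eqP ->; rewrite gt0_muley ?lte_fin// leey.
set G := \int[leb2]_(z in OmegaM M) g z in Goo *.
have G0 : 0 <= G by apply: integral_ge0.
have [r r0 GE] : exists2 r : R, (0 <= r)%R & G = r%:E.
  exists (fine G); first by rewrite fine_ge0.
  by rewrite fineK// ge0_fin_numE.
pose f z := (trunc_weight z ^+ 2)%:E * g z.
have mf : measurable_fun setT f.
  apply: emeasurable_funM => //; apply/measurable_EFinP; apply: measurable_funX.
  exact: measurable_trunc_weight.
have f0 z : 0 <= f z by rewrite mule_ge0// lee_fin sqr_ge0.
have mI : measurable_fun setT (fun x => \int[pdfin x]_z f z).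
  apply: (@measurable_integral_pdfin _ _ _ id _ (fun xz => f xz.2)) => //.
  exact: (measurableT_comp mf).
pose H x := (card_pd x)%:E * \int[pdfin x]_z f z.
have mH : measurable_fun setT H.
  by apply: emeasurable_funM => //; apply/measurable_EFinP; exact: measurable_card_pd.
have H0 x : 0 <= H x.
  by rewrite mule_ge0 ?lee_fin ?card_pd_ge0// integral_ge0.
rewrite -/H GE.
case: PP => d [T [Pr [D [[mD lawD] _ DM [Z [h [p_ [[mZ Z0] Dh p_dens sumN]]]]]]]].
rewrite -(ge0_integral_image mD lawD mH H0).
have mHD : measurable_fun setT (fun t => H (D t)) by exact: measurableT_comp mH mD.
pose E l := Z @^-1` [set l].
have mE l : measurable (E l) by rewrite -[X in measurable X]setTI; exact: mZ.
have E_cover : setT = \bigcup_l E l.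
  by apply/seteqP; split => // t _; exists (Z t).
have E_disj : trivIset setT E.
  by move=> i j _ _ [t [/= <- <-]].
pose nrm l := 'N[leb2]_+oo[(fun z => ((w z) ^+ 2 * p_ l z)%:E)].
pose B l := (h l)%:E * nrm l * Pr (E l).
have nrm0 l : 0 <= nrm l by exact: Lnorm_ge0.
(* A negative [h l] would contradict the bound on the cardinality on an event of positive
   probability. *)
have h0 l : (0 < Pr (E l)) -> (0 <= h l)%R.
  move=> PEl; rewrite leNgt; apply/negP => hl.
  case: Dh => A [mA A0 sA].
  suff : Pr (E l) <= 0 by rewrite leNgt PEl.
  rewrite -A0; apply: le_measure; rewrite ?inE// => t Et.
  apply: sA => /=; rewrite Et; apply/negP; rewrite -ltNge.
  by apply: lt_le_trans (measure_ge0 _ _); rewrite lte_fin.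
have PE_cases l : Pr (E l) = 0 \/ 0 < Pr (E l).
  have [->|] := eqVneq (Pr (E l)) 0; first by left.
  by rewrite neq_lt ltNge measure_ge0/=; right.
have B0 l : 0 <= B l.
  rewrite /B; have [->|PEl] := PE_cases l; first by rewrite mule0.
  by rewrite mule_ge0// mule_ge0// lee_fin h0.
rewrite {1}E_cover ge0_integral_bigcup//; last by rewrite -E_cover.
(* Z takes positive values, so the l = 0 term drops out and the series starts at 1 as in the
   hypothesis. *)
have E00 : E 0%N = set0.
  by apply/seteqP; split => // t /= Zt; have := Z0 t; rewrite Zt.
rewrite nneseries_recl//; last by move=> l _; exact: integral_ge0.
rewrite E00 integral_set0 add0e.
apply: (@le_trans _ _ (\sum_(1 <= l <oo) (r%:E * B l))); last first.
  rewrite nneseriesZl//.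
  by rewrite [leRHS]muleC; apply: lee_wpmul2l; [rewrite lee_fin|exact: sumN].
apply: lee_nneseries => [l _ _|l _]; first exact: integral_ge0.
have [PEl|PEl] := PE_cases l.
  rewrite null_set_integral//; first by rewrite mule_ge0// lee_fin.
  exact: measurable_funTS.
have := p_dens _ PEl => -[mpl pl0 plO pld].
have PEfin : Pr (E l) \is a fin_num by exact: fin_num_measure.
have PE0 : (0 < fine (Pr (E l)))%R by rewrite fine_gt0// PEl -ge0_fin_numE.
have dens A : measurable A -> A `<=` Omega ->
    \int[Pr]_(t in E l) pd_eval (D t) A =
    (fine (Pr (E l)))%:E * \int[leb2]_(z in A) (p_ l z)%:E.
  move=> mA AO; rewrite -(pld A mA AO) /conditional_mean -/(E l).
  by rewrite muleA -EFinM mulfV ?gt_eqF// mul1e.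
have [mID ID] := integral_mean_measure (mE l) mD mpl pl0 plO dens mf f0.
apply: (@le_trans _ _ ((h l)%:E * \int[Pr]_(t in E l) \int[pd_eval (D t)]_z f z)).
  rewrite -ge0_integralZl//; last 2 first.
  - by move=> t _; apply: integral_ge0.
  - by rewrite lee_fin h0.
  apply: ae_ge0_le_integral => //.
  - exact: measurable_funTS.
  - by move=> t _; rewrite mule_ge0 ?lee_fin ?h0// integral_ge0.
  - exact: measurable_funeM.
  - apply: filterS Dh => t Dth Et; rewrite /H.
    rewrite Et in Dth.
    have Dfin : pd_eval (D t) setT < +oo by apply: le_lt_trans Dth (ltry _).
    have -> : \int[pdfin (D t)]_z f z = \int[pd_eval (D t)]_z f z.
      by apply: eq_measure_integral => A mA _; rewrite -[LHS]/(pdfin (D t) A) pdfinE.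
    apply: lee_wpmul2r; first exact: integral_ge0.
    by rewrite -card_pdE pdfinE.
rewrite ID.
(* If [h l] vanishes, the convention 0 * oo = 0 permits an infinite essential norm, but then the
   left side is 0. Otherwise the finiteness of [B l] forces that of [nrm l]. *)
have [hl0|hlN0] := eqVneq (h l) 0%R.
  by rewrite hl0 mul0e mule_ge0// lee_fin.
have hl : (0 < h l)%R by rewrite lt_neqAle eq_sym hlN0 h0.
have Boo : B l < +oo.
  apply: le_lt_trans _ (le_lt_trans sumN (ltry _)).
  have l1 : (1 <= l)%N.
    by rewrite lt0n; apply: contraTneq PEl => ->; rewrite E00 measure0 ltxx.
  apply: le_trans (@nneseries_lim_ge _ B xpredT 1%N l.+1 _); last by [].
  rewrite big_nat_recr//= leeDr//.
  by apply: sume_ge0.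
have nfin : nrm l \is a fin_num.
  rewrite ge0_fin_numE//; rewrite ltNge leye_eq; apply/negP => /eqP nl.
  by move: Boo; rewrite /B nl gt0_muley ?lte_fin// gt0_mulye// ltxx.
have ae_nrm : {ae leb2, forall z : plane R, ((w z) ^+ 2 * p_ l z)%:E <= nrm l}.
  (* The norm of order +oo is an essential supremum only for a measure of positive total mass; for
     the zero measure every property holds almost everywhere. *)
  have [mu0|mu0] := ltP 0 (@leb2 R setT).
    rewrite /nrm unlock mu0.
    apply: filterS (ess_sup_ge leb2 _) => z /=; apply: le_trans.
    by rewrite lee_fin ler_norm.
  exists setT; split => //; apply/eqP.
  by rewrite -measure_le0.
have -> : \int[leb2]_z (f z * (p_ l z)%:E) =
    \int[leb2]_(z in OmegaM M) (((w z) ^+ 2 * p_ l z)%:E * g z).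
  rewrite [RHS]integral_mkcond; apply: eq_integral => z _.
  rewrite patchE /f /trunc_weight indicE; case: ifPn => zO.
    by rewrite mulr1 muleAC -EFinM.
  by rewrite mulr0 expr0n/= !mul0e.
have mwp : measurable_fun setT (fun z => ((w z) ^+ 2 * p_ l z)%R).
  by apply: measurable_funM => //; exact: measurable_funX.
apply: (@le_trans _ _ ((h l)%:E * ((fine (Pr (E l)))%:E * (nrm l * G)))); last first.
  rewrite /B GE -(fineK nfin) -{2}(fineK PEfin) -!EFinM lee_fin.
  by rewrite le_eqVlt; apply/orP; left; apply/eqP; ring.
apply: lee_wpmul2l; first by rewrite lee_fin ltW.
apply: lee_wpmul2l; first by rewrite lee_fin ltW.
rewrite -ge0_integralZl//; last exact: measurable_funTS.
apply: ae_ge0_le_integral => //.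
- by move=> z _; rewrite mule_ge0// lee_fin mulr_ge0// sqr_ge0.
- apply: measurable_funTS; apply: emeasurable_funM => //.
  exact/measurable_EFinP.
- by move=> z _; rewrite mule_ge0.
- by apply: measurable_funeM; exact: measurable_funTS.
- by apply: filterS ae_nrm => z zn _; apply: lee_wpmul2r.
Qed.

Lemma classP_second_moment (u : plane R -> R) : measurable_fun setT u ->
  \int[P]_x ((\int[pdfin x]_z `|trunc_weight z * u z|%:E) ^+ 2)
    <= N%:E * \int[leb2]_(z in OmegaM M) (u z ^+ 2)%:E.
Proof.
move=> mu; have mtw := measurable_trunc_weight.
apply: le_trans (classP_moment (measurable_sqr mu) _); last first.
  by move=> z; rewrite lee_fin sqr_ge0.
apply: ge0_le_integral_any => x; first by rewrite expe2 mule_ge0// integral_ge0.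
have mtu : measurable_fun setT (fun z => trunc_weight z * u z)%R.
  exact: measurable_funM.
apply: le_trans (sqr_integral_le (pdfin x) mtu) _.
rewrite -[X in X * _ <= _]/(pdfin x setT) card_pdE.
rewrite le_eqVlt; apply/orP; left; apply/eqP; congr (_ * _).
by apply: eq_integral => z _; rewrite exprMn.
Qed.

End diagram_moments.

(** * The smoothing kernel *)

Section affine_substitution.
Local Open Scope ereal_scope.
Variables (R : realType) (x l : R).
Hypothesis l0 : (0 < l)%R.
Local Notation mu := (@lebesgue_measure R).

Let T (z : measurableTypeR R) : measurableTypeR R := ((x - z) / l)%R.

Let measurable_T : measurable_fun setT T.
Proof. by apply: measurable_funM => //; exact: measurable_funB. Qed.

Let l0' : (0 <= l^-1)%R. Proof. by rewrite invr_ge0 ltW. Qed.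

Lemma lebesgue_measure_affine (B : set (measurableTypeR R)) : measurable B ->
  mu (T @^-1` B) = l%:E * mu B.
Proof.
move=> mB.
pose m_ := mscale (NngNum l0') (pushforward mu T).
pose m := m_ measurable_T.
suff -> : mu B = m B.
  by rewrite /m /m_/= /mscale/= muleA -EFinM mulfV ?gt_eqF// mul1e.
apply: lebesgue_measure_unique => // _ [[a b] _ <-] /=.
rewrite /m /m_/= /mscale/= /pushforward/=.
(* The map reverses orientation, so the closed end changes side; the length is only rescaled. *)
have -> : T @^-1` `]a, b]%classic = `[(x - l * b)%R, (x - l * a)%R[%classic.
  apply/seteqP; split => z; rewrite /T/= !in_itv/= => /andP[h1 h2].
    move: h1 h2; rewrite ltr_pdivlMr// ler_pdivrMr// => h1 h2.
    by apply/andP; split; lra.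
  by apply/andP; split; rewrite ?ltr_pdivlMr ?ler_pdivrMr//; lra.
rewrite !lebesgue_measure_itv/= !lte_fin ltrD2l ltrN2 ltr_pM2l//.
case: ifP => _; last by rewrite mule0.
rewrite -!EFinD -EFinM; congr (_%:E).
by field; rewrite gt_eqF.
Qed.

Lemma integral_affine (f : measurableTypeR R -> \bar R) :
  measurable_fun setT f -> (forall z, 0 <= f z) ->
  \int[mu]_z f ((x - z) / l)%R = l%:E * \int[mu]_z f z.
Proof.
move=> mf f0; rewrite -[l]/((NngNum (ltW l0))%:num) -ge0_integral_mscale//.
apply: (ge0_integral_image measurable_T) => // B mB.
exact: lebesgue_measure_affine.
Qed.

End affine_substitution.

Section kernel_integral.
Local Open Scope ereal_scope.
Variable R : realType.

Lemma kernel_factor_measurable (k : measurableTypeR R -> R) :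
  kernel_factor k -> measurable_fun setT k.
Proof.
case=> _ _ [/Lfun1_integrable ik _] _ _.
by apply/measurable_EFinP; exact: measurable_int ik.
Qed.

(** Positive definiteness at the points x and 0 with coefficients 1 and -1 reads 2 k(0) - 2 k(x) >=
    0. The kernel is therefore bounded, and potentials of finite diagrams are finite. *)
Lemma kernel_factor_le (k : measurableTypeR R -> R) x :
  kernel_factor k -> (k x <= k 0)%R.
Proof.
case=> k0 pd _ ksym _.
have := pd 2%N (fun i => if i == ord0 then x else 0)%R
  (fun i => if i == ord0 then 1 else -1)%R.
rewrite !big_ord_recl !big_ord0/= !subrr !subr0 sub0r ksym.
lra.
Qed.

Lemma kernel_factor_sqr (k : measurableTypeR R -> R) : kernel_factor k ->
  \int[lebesgue_measure]_x (k x ^+ 2)%:E < +oo.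
Proof.
case=> _ _ [_ k2] _ _.
have /(integrable_fin_num measurableT) := Lfun2_integrable_sqr k2.
by rewrite ge0_fin_numE// integral_ge0// => x _; rewrite lee_fin sqr_ge0.
Qed.

Variables (k1 k2 : measurableTypeR R -> R) (lam : R * R).
Hypothesis mk1 : measurable_fun setT k1.
Hypothesis mk2 : measurable_fun setT k2.
Hypothesis l1 : (0 < lam.1)%R.
Hypothesis l2 : (0 < lam.2)%R.

Lemma measurable_phi : measurable_fun setT (phi k1 k2 lam).
Proof.
apply: measurable_funM; apply: measurable_funM => //.
- apply: (measurableT_comp mk1).
  by apply: measurable_funM.
- apply: (measurableT_comp mk2).
  by apply: measurable_funM.
Qed.

Lemma integral_scaled_sqr (k : measurableTypeR R -> R) (x l : R) :
  measurable_fun setT k -> (0 < l)%R ->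
  \int[lebesgue_measure]_z ((l^-1 * k ((x - z) / l)) ^+ 2)%:E
    = (l^-1)%:E * \int[lebesgue_measure]_z (k z ^+ 2)%:E.
Proof.
move=> mk l0.
rewrite (@integral_affine _ x l l0 (fun z => ((l^-1 * k z) ^+ 2)%:E)); last 2 first.
- by apply: measurable_sqr; exact: measurable_funM.
- by move=> z; rewrite lee_fin sqr_ge0.
under eq_integral do rewrite exprMn EFinM.
rewrite ge0_integralZl//; last 3 first.
- exact: measurable_sqr.
- by move=> z _; rewrite lee_fin sqr_ge0.
- by rewrite lee_fin sqr_ge0.
rewrite muleA -EFinM; congr (_%:E * _).
by rewrite expr2 mulrA mulfV ?mul1r// gt_eqF.
Qed.

Lemma integral_phi_sqr (x : plane R) :
  \int[leb2]_z (phi k1 k2 lam ((x.1 : R) - z.1, (x.2 : R) - z.2)%R ^+ 2)%:E =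
  ((lam.1 * lam.2)^-1)%:E * (\int[lebesgue_measure]_z (k1 z ^+ 2)%:E
    * \int[lebesgue_measure]_z (k2 z ^+ 2)%:E).
Proof.
pose f (z : plane R) := (phi k1 k2 lam ((x.1 : R) - z.1, (x.2 : R) - z.2)%R ^+ 2)%:E.
have mf : measurable_fun setT f.
  apply: measurable_sqr; apply: (measurableT_comp measurable_phi).
  by apply: measurable_fun_pair; exact: measurable_funB.
have f0 z : 0 <= f z by rewrite lee_fin sqr_ge0.
rewrite -[LHS]/(\int[(lebesgue_measure \x lebesgue_measure)%E]_z f z).
rewrite (@fubini_tonelli1 _ _ _ _ _ lebesgue_measure lebesgue_measure f mf f0) /fubini_F/=.
pose a z := ((lam.1^-1 * k1 (((x.1 : R) - z) / lam.1)) ^+ 2)%R.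
pose b z := ((lam.2^-1 * k2 (((x.2 : R) - z) / lam.2)) ^+ 2)%R.
have ma : measurable_fun setT (EFin \o a).
  apply: measurable_sqr; apply: measurable_funM => //.
  apply: (measurableT_comp mk1); apply: measurable_funM => //.
  exact: measurable_funB.
have mb : measurable_fun setT (EFin \o b).
  apply: measurable_sqr; apply: measurable_funM => //.
  apply: (measurableT_comp mk2); apply: measurable_funM => //.
  exact: measurable_funB.
transitivity (\int[lebesgue_measure]_z1 ((a z1)%:E * \int[lebesgue_measure]_z2 (b z2)%:E)).
  apply: eq_integral => z1 _; rewrite -ge0_integralZl//.
  - by apply: eq_integral => z2 _; rewrite /f /phi/= exprMn.
  - by move=> z _; rewrite lee_fin sqr_ge0.
  - by rewrite lee_fin sqr_ge0.
rewrite ge0_integralZr//; last 2 first.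
- by move=> z _; rewrite lee_fin sqr_ge0.
- by apply: integral_ge0 => z _; rewrite lee_fin sqr_ge0.
rewrite /a /b !integral_scaled_sqr//.
by rewrite invfM EFinM muleACA.
Qed.

End kernel_integral.

(** * Lebesgue measure of the plane: rectangles and sigma-finiteness *)

Section plane_lebesgue.
Local Open Scope ereal_scope.
Variable R : realType.

Lemma leb2X (A B : set (measurableTypeR R)) : measurable A -> measurable B ->
  leb2 (A `*` B) = lebesgue_measure A * lebesgue_measure B.
Proof.
move=> mA mB.
by rewrite -[LHS]/((lebesgue_measure \x lebesgue_measure) (A `*` B)) product_measure1E.
Qed.

Lemma leb2_sigma_finite : sigma_finite setT (@leb2 R).
Proof.
pose S n : set (measurableTypeR R) := `[(- n%:R)%R, n%:R%R]%classic.
have mS n : measurable (S n) by exact: measurable_itv.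
exists (fun n => S n `*` S n).
  apply/seteqP; split => // -[x y] _.
  have bnd (z : R) m : (Num.bound `|z| <= m)%N -> S m z.
    move=> zm; rewrite /S/= in_itv/= -ler_norml.
    by apply: le_trans (ltW (archi_boundP (normr_ge0 z))) _; rewrite ler_nat.
  exists (maxn (Num.bound `|x|) (Num.bound `|y|))%R => //.
  by split; apply: bnd; rewrite ?leq_maxl ?leq_maxr.
move=> n; split; first exact: measurableX.
rewrite leb2X//= /S lebesgue_measure_itv.
by case: ifP => _; rewrite ?mule0// -EFinD -EFinM ltry.
Qed.

(** [leb2] is typed as a plain measure, whereas Tonelli on diagrams times the plane asks for a
    sigma-finite one. *)
Definition sigma_finite_leb2 : {sigma_finite_measure set (plane R) -> \bar R} :=
  HB.pack_for {sigma_finite_measure set (plane R) -> \bar R} (Measure.sort (@leb2 R))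
    (Measure_isSigmaFinite.Build _ _ _ (@leb2 R) leb2_sigma_finite).

End plane_lebesgue.

Section regular_diagrams.
Local Open Scope ereal_scope.
Variables (R : realType) (M : R) (w : plane R -> R).

Local Notation tw := (trunc_weight M w).

Lemma ae_OmegaM_regular (x : PD R) : regular_pd M x ->
  {ae pd_eval x, forall z, OmegaM M z}.
Proof.
move=> [_ xM]; exists (~` OmegaM M); split => //.
by apply: measurableC; exact: measurable_OmegaM.
Qed.

Lemma integral_pdfin (x : PD R) (f : plane R -> \bar R) : pd_eval x setT < +oo ->
  \int[pdfin x]_z f z = \int[pd_eval x]_z f z.
Proof.
move=> xoo; apply: eq_measure_integral => A mA _.
by rewrite -[LHS]/(pdfin x A) pdfinE.
Qed.

Lemma trunc_weightE z : OmegaM M z -> tw z = w z.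
Proof. by move=> zO; rewrite /trunc_weight indicE mem_set// mulr1. Qed.

End regular_diagrams.

(** * Potentials and the kernel between diagrams *)

Section diagram_kernel.
Local Open Scope ereal_scope.
Variables (R : realType) (M N B : R) (w : plane R -> R).
Variables (k1 k2 : measurableTypeR R -> R) (lam : R * R).
Hypothesis M0 : (0 < M)%R.
Hypothesis mw : measurable_fun setT w.
Hypothesis w0 : forall z, OmegaM M z -> (0 <= w z)%R.
Hypothesis wB : forall z, OmegaM M z -> (w z <= B)%R.
Hypothesis B0 : (0 <= B)%R.
Hypothesis N0 : (0 < N)%R.
Hypothesis hk1 : kernel_factor k1.
Hypothesis hk2 : kernel_factor k2.
Hypothesis l1 : (0 < lam.1)%R.
Hypothesis l2 : (0 < lam.2)%R.

Local Notation tw := (trunc_weight M w).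
Local Notation kl := (klam k1 k2 lam).

Lemma trunc_weight_ge0 z : (0 <= tw z)%R.
Proof.
rewrite /trunc_weight indicE; have [/set_mem zO|_] := boolP (z \in OmegaM M); last by rewrite mulr0.
by rewrite mulr1 w0.
Qed.

Lemma trunc_weight_le z : (tw z <= B)%R.
Proof.
rewrite /trunc_weight indicE; have [/set_mem zO|_] := boolP (z \in OmegaM M); last by rewrite mulr0.
by rewrite mulr1 wB.
Qed.

Let mtw : measurable_fun setT tw := measurable_trunc_weight M mw.

Lemma klam_ge0 z z' : (0 <= kl z z')%R.
Proof.
have [k10 _ _ _ _] := hk1; have [k20 _ _ _ _] := hk2.
by rewrite /klam /phi !mulr_ge0 ?invr_ge0// ltW.
Qed.

Definition klam_max : R := ((lam.1^-1 * k1 0) * (lam.2^-1 * k2 0))%R.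

Lemma klam_le z z' : (kl z z' <= klam_max)%R.
Proof.
have le_max (k : measurableTypeR R -> R) x l : kernel_factor k -> (0 < l)%R ->
    (l^-1 * k x <= l^-1 * k 0)%R.
  by move=> hk l0; rewrite ler_pM2l ?invr_gt0//; exact: kernel_factor_le.
have [k10 _ _ _ _] := hk1; have [k20 _ _ _ _] := hk2.
by apply: ler_pM; rewrite ?le_max// mulr_ge0// invr_ge0 ltW.
Qed.

Lemma klamC z z' : kl z z' = kl z' z.
Proof.
have [_ _ _ k1N _] := hk1; have [_ _ _ k2N _] := hk2.
rewrite /klam /phi/= -[in RHS]k1N -[in RHS]k2N.
by rewrite -!mulNr !opprB.
Qed.

Lemma measurable_klam : measurable_fun setT (fun zz => kl zz.1 zz.2).
Proof.
have mphi := measurable_phi lam (kernel_factor_measurable hk1)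
  (kernel_factor_measurable hk2).
apply: (measurableT_comp mphi); apply: measurable_fun_pair.
  apply: measurable_funB; apply: (@measurableT_comp _ _ _ _ _ _ fst) => //.
by apply: measurable_funB; apply: (@measurableT_comp _ _ _ _ _ _ snd).
Qed.

Lemma measurable_klamr z : measurable_fun setT (kl z).
Proof. exact: (measurableT_comp measurable_klam (pair1_measurable z)). Qed.

(** The square of the L2 norm of phi_lambda, from which the factor 1 / (lam1 lam2) of the theorem
    originates. *)
Definition klam_norm : R :=
  fine (((lam.1 * lam.2)^-1)%:E * (\int[lebesgue_measure]_z (k1 z ^+ 2)%:E
    * \int[lebesgue_measure]_z (k2 z ^+ 2)%:E)).

Lemma integral_klam_sqr z : \int[leb2]_z' (kl z z' ^+ 2)%:E = klam_norm%:E.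
Proof.
rewrite /klam_norm fineK; last first.
  rewrite fin_numM// fin_numM// ge0_fin_numE.
  - exact: kernel_factor_sqr.
  - by apply: integral_ge0 => x _; rewrite lee_fin sqr_ge0.
  - exact: kernel_factor_sqr.
  - by apply: integral_ge0 => x _; rewrite lee_fin sqr_ge0.
rewrite -(integral_phi_sqr (kernel_factor_measurable hk1)
  (kernel_factor_measurable hk2) l1 l2 z)//.
Qed.

Lemma leb2_OmegaM : @leb2 R (OmegaM M) <= (M ^+ 2)%:E.
Proof.
pose S : set (measurableTypeR R) := `[0%R, M]%classic.
apply: (@le_trans _ _ (leb2 (S `*` S))).
  apply: le_measure; rewrite ?inE.
  - exact: measurable_OmegaM.
  - by apply: measurableX; exact: measurable_itv.
  - move=> z [[z0 z12] zM]; split; rewrite /S/= in_itv/=; apply/andP; split => //.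
    + exact: ltW (lt_trans z12 zM).
    + exact: le_trans z0 (ltW z12).
    + exact: ltW.
have mS : measurable S by exact: measurable_itv.
by rewrite leb2X// /S lebesgue_measure_itv/= lte_fin M0 -EFinD subr0 -EFinM expr2.
Qed.

Definition potential (y : PD R) (z : plane R) : \bar R :=
  \int[pdfin y]_z' (tw z' * kl z z')%:E.

Lemma potential_ge0 y z : 0 <= potential y z.
Proof.
apply: integral_ge0 => z' _.
by rewrite lee_fin mulr_ge0// ?trunc_weight_ge0 ?klam_ge0.
Qed.

Lemma measurable_twkl z : measurable_fun setT (fun z' => tw z' * kl z z')%R.
Proof. by apply: measurable_funM => //; exact: measurable_klamr. Qed.

Lemma potential_le y z : potential y z <= (B * klam_max * card_pd y)%:E.
Proof.
rewrite EFinM -card_pdE -[X in _ * X]/((pdfin y : {measure set _ -> \bar R}) setT).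
rewrite -(integral_cst (pdfin y) measurableT).
apply: ge0_le_integral => //.
- by move=> z' _; rewrite lee_fin mulr_ge0// ?trunc_weight_ge0 ?klam_ge0.
- by apply/measurable_EFinP; exact: measurable_twkl.
- by move=> z' _; rewrite lee_fin ler_pM ?trunc_weight_ge0 ?klam_ge0
    ?trunc_weight_le ?klam_le.
Qed.

Lemma potential_fin_num y z : potential y z \is a fin_num.
Proof.
rewrite ge0_fin_numE; last exact: potential_ge0.
by apply: le_lt_trans (potential_le y z) (ltry _).
Qed.

Lemma measurable_potential :
  measurable_fun setT (fun yz : PD R * plane R => potential yz.1 yz.2).
Proof.
apply: (@measurable_integral_pdfin _ _ _ fst _
  (fun q : (PD R * plane R) * plane R => (tw q.2 * kl q.1.2 q.2)%:E)) => //.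
- apply/measurable_EFinP; apply: measurable_funM.
    exact: (measurableT_comp mtw).
  have mq : measurable_fun setT
      (fun q : (PD R * plane R) * plane R => (q.1.2, q.2)).
    apply: measurable_fun_pair => //.
    exact: (measurableT_comp measurable_snd measurable_fst).
  exact: (measurableT_comp measurable_klam mq).
- by move=> q; rewrite lee_fin mulr_ge0// ?trunc_weight_ge0 ?klam_ge0.
Qed.

Lemma measurable_potentialr y : measurable_fun setT (potential y).
Proof. exact: (measurableT_comp measurable_potential (pair1_measurable y)). Qed.

Lemma measurable_potentiall z : measurable_fun setT (potential^~ z).
Proof. exact: (measurableT_comp measurable_potential (pair2_measurable z)). Qed.

(** A version of [Klam] that is finite, nonnegative, symmetric and measurable on all pairs of
    diagrams, as the Hoeffding section requires. *)
Definition Kfine (x y : PD R) : R := fine (\int[pdfin x]_z ((tw z)%:E * potential y z)).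

Lemma KfineE x y : \int[pdfin x]_z ((tw z)%:E * potential y z) = (Kfine x y)%:E.
Proof.
rewrite fineK// ge0_fin_numE; last first.
  apply: integral_ge0 => z _.
  by rewrite mule_ge0 ?potential_ge0// lee_fin trunc_weight_ge0.
apply: (@le_lt_trans _ _ (\int[pdfin x]_z (B * (B * klam_max * card_pd y))%:E)).
  apply: ge0_le_integral => //.
  - move=> z _; by rewrite mule_ge0 ?potential_ge0// lee_fin trunc_weight_ge0.
  - apply: emeasurable_funM; last exact: measurable_potentialr.
    exact/measurable_EFinP.
  - move=> z _; rewrite [leRHS]EFinM.
    apply: lee_pmul; rewrite ?potential_ge0 ?lee_fin ?trunc_weight_ge0//.
      exact: trunc_weight_le.
    exact: potential_le.
rewrite integral_cst// -[X in _ * X]/(pdfin x setT) card_pdE -EFinM; exact: ltry.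
Qed.

Lemma Kfine_ge0 x y : (0 <= Kfine x y)%R.
Proof.
rewrite fine_ge0// integral_ge0// => z _.
by rewrite mule_ge0 ?potential_ge0// lee_fin trunc_weight_ge0.
Qed.

Lemma measurable_Kfine : measurable_fun setT (fun xy : PD R * PD R => Kfine xy.1 xy.2).
Proof.
apply: (measurableT_comp (fine_measurable measurableT)).
apply: (@measurable_integral_pdfin _ _ _ fst _
  (fun q : (PD R * PD R) * plane R => (tw q.2)%:E * potential q.1.2 q.2)) => //.
- apply: emeasurable_funM.
    by apply/measurable_EFinP; exact: (measurableT_comp mtw).
  have mq : measurable_fun setT
      (fun q : (PD R * PD R) * plane R => (q.1.2, q.2)).
    apply: measurable_fun_pair => //.
    exact: (measurableT_comp measurable_snd measurable_fst).
  exact: (measurableT_comp measurable_potential mq).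
- by move=> q; rewrite mule_ge0 ?potential_ge0// lee_fin trunc_weight_ge0.
Qed.

Lemma KfineC x y : Kfine x y = Kfine y x.
Proof.
apply: EFin_inj; rewrite -!KfineE.
pose f (q : plane R * plane R) := ((tw q.1 * tw q.2 * kl q.1 q.2)%R)%:E.
have mf : measurable_fun setT f.
  apply/measurable_EFinP; apply: measurable_funM; last exact: measurable_klam.
  by apply: measurable_funM; exact: (measurableT_comp mtw).
have f0 q : 0 <= f q.
  rewrite lee_fin; apply: mulr_ge0 (klam_ge0 _ _).
  by apply: mulr_ge0; exact: trunc_weight_ge0.
have expand (a b : PD R) : \int[pdfin a]_z ((tw z)%:E * potential b z) =
    \int[pdfin a]_z \int[pdfin b]_z' f (z, z').
  apply: eq_integral => z _; rewrite -ge0_integralZl//.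
  - by apply: eq_integral => z' _; rewrite /f/= -EFinM mulrA.
  - by apply/measurable_EFinP; exact: measurable_twkl.
  - by move=> z' _; rewrite lee_fin mulr_ge0// ?trunc_weight_ge0 ?klam_ge0.
  - by rewrite lee_fin trunc_weight_ge0.
rewrite !expand (@fubini_tonelli _ _ _ _ _ (pdfin x) (pdfin y) f mf f0).
apply: eq_integral => z _; apply: eq_integral => z' _.
by rewrite /f/= klamC [(tw z' * _)%R]mulrC.
Qed.

Definition second_moment_bound (P : probability (PD R) R) :=
  forall u : plane R -> R, measurable_fun setT u ->
  \int[P]_x ((\int[pdfin x]_z `|tw z * u z|%:E) ^+ 2)
    <= N%:E * \int[leb2]_(z in OmegaM M) (u z ^+ 2)%:E.

Lemma second_moment_potential P z : second_moment_bound P ->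
  \int[P]_y (potential y z ^+ 2) <= (N * klam_norm)%:E.
Proof.
move=> PN; apply: le_trans (_ : N%:E * \int[leb2]_(z' in OmegaM M) (kl z z' ^+ 2)%:E <= _).
  apply: le_trans (PN _ (measurable_klamr z)).
  rewrite le_eqVlt; apply/orP; left; apply/eqP; apply: eq_integral => y _.
  congr (_ ^+ 2); apply: eq_integral => z' _; rewrite ger0_norm//.
  by rewrite mulr_ge0// ?trunc_weight_ge0 ?klam_ge0.
rewrite EFinM -(integral_klam_sqr z); apply: lee_wpmul2l; first by rewrite lee_fin ltW.
apply: ge0_subset_integral => //.
- exact: measurable_OmegaM.
- by apply: measurable_sqr; exact: measurable_klamr.
- by move=> z' _; rewrite lee_fin sqr_ge0.
Qed.

Lemma second_moment_Kfine P y : second_moment_bound P ->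
  \int[P]_x (Kfine x y ^+ 2)%:E
    <= N%:E * \int[leb2]_(z in OmegaM M) (potential y z ^+ 2).
Proof.
move=> PN; have mp : measurable_fun setT (fun z => fine (potential y z)).
  exact: (measurableT_comp (fine_measurable measurableT) (measurable_potentialr y)).
have pE z : (fine (potential y z))%:E = potential y z by rewrite fineK// potential_fin_num.
under [in leRHS]eq_integral do rewrite -pE.
apply: le_trans (PN _ mp).
rewrite le_eqVlt; apply/orP; left; apply/eqP; apply: eq_integral => x _.
rewrite -[LHS]/((Kfine x y)%:E ^+ 2) -KfineE; congr (_ ^+ 2).
apply: eq_integral => z _; rewrite ger0_norm ?EFinM ?pE//.
by rewrite mulr_ge0 ?trunc_weight_ge0// fine_ge0// potential_ge0.
Qed.

Lemma klam_norm_ge0 : (0 <= klam_norm)%R.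
Proof.
rewrite -lee_fin -(integral_klam_sqr (0%R, 0%R)).
by apply: integral_ge0 => z _; rewrite lee_fin sqr_ge0.
Qed.

(** Only finiteness is wanted, so the potential is bounded crudely by a constant depending on y;
    that constant does not enter the final estimate. *)
Lemma Kfine_integrable P y : second_moment_bound P ->
  \int[P]_x (Kfine x y)%:E < +oo.
Proof.
move=> PN.
have mK : measurable_fun setT (Kfine^~ y).
  exact: (measurableT_comp measurable_Kfine (pair2_measurable y)).
suff : \int[P]_x (Kfine x y ^+ 2)%:E < +oo.
  move=> /(integrable_of_sqr mK)/(integrable_fin_num measurableT) /=.
  by rewrite ge0_fin_numE// integral_ge0// => x _; rewrite lee_fin Kfine_ge0.
apply: le_lt_trans (second_moment_Kfine y PN) _.
apply: lte_mul_pinfty; [by rewrite lee_fin ltW|by []|].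
apply: (@le_lt_trans _ _ (\int[leb2]_(z in OmegaM M) (((B * klam_max * card_pd y) ^+ 2)%:E))).
  have mO := @measurable_OmegaM R M.
  apply: ge0_le_integral => //.
  - by move=> z _; rewrite expe2 mule_ge0// potential_ge0.
  - apply: measurable_funTS; under eq_fun do rewrite expe2.
    by apply: emeasurable_funM; exact: measurable_potentialr.
  - move=> z _; rewrite expe2 expr2 EFinM.
    by apply: lee_pmul; rewrite ?potential_ge0 ?potential_le.
rewrite integral_cst//; last exact: measurable_OmegaM.
apply: lte_mul_pinfty; [by rewrite lee_fin sqr_ge0|by []|].
by apply: le_lt_trans leb2_OmegaM (ltry _).
Qed.

(** The bound in x leaves the squared potential of y integrated over [OmegaM M]. After Tonelli the
    bound in y is uniform in z, so the remaining integral costs the area of [OmegaM M]. *)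
Lemma second_moment_Kfine2 P Q : second_moment_bound P -> second_moment_bound Q ->
  \int[Q]_y \int[P]_x (Kfine x y ^+ 2)%:E <= (N ^+ 2 * klam_norm * M ^+ 2)%:E.
Proof.
move=> PN QN; have mO := @measurable_OmegaM R M.
(* The restriction to [OmegaM M] is moved into the integrand so that Tonelli applies on the whole
   product. *)
pose f (q : PD R * plane R) := ((fun q => potential q.1 q.2 ^+ 2) \_ (setT `*` OmegaM M)) q.
have f0 q : 0 <= f q.
  by rewrite /f; apply: erestrict_ge0 => q' _; rewrite expe2 mule_ge0// potential_ge0.
have mf : measurable_fun setT f.
  apply/(measurable_restrictT _ _).1; first exact: measurableX.
  apply: measurable_funTS; under eq_fun do rewrite expe2.
  by apply: emeasurable_funM; exact: measurable_potential.
have fE y : \int[leb2]_(z in OmegaM M) (potential y z ^+ 2) = \int[leb2]_z f (y, z).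
  rewrite integral_mkcond; apply: eq_integral => z _; rewrite /f !patchE.
  by rewrite in_setX in_setT.
apply: (@le_trans _ _ (\int[Q]_y (N%:E * \int[leb2]_z f (y, z)))).
  apply: ge0_le_integral_any => y.
    by apply: integral_ge0 => x _; rewrite lee_fin sqr_ge0.
  by rewrite -fE; exact: second_moment_Kfine.
rewrite ge0_integralZl//; last 3 first.
- have := @measurable_fun_fubini_tonelli_F _ _ _ _ _
    (sigma_finite_leb2 R) f mf f0.
  exact.
- by move=> y _; exact: integral_ge0.
- by rewrite lee_fin ltW.
rewrite (@fubini_tonelli _ _ _ _ _ Q (sigma_finite_leb2 R) f mf f0).
rewrite expr2 -mulrA -mulrA EFinM; apply: lee_wpmul2l; first by rewrite lee_fin ltW.
rewrite mulrA EFinM.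
apply: (@le_trans _ _ (\int[leb2]_(z in OmegaM M) (N * klam_norm)%:E)); last first.
  rewrite integral_cst//; apply: lee_wpmul2l; last exact: leb2_OmegaM.
  by rewrite lee_fin mulr_ge0 ?klam_norm_ge0// ltW.
rewrite [leRHS]integral_mkcond; apply: ge0_le_integral_any => z.
  by apply: integral_ge0.
rewrite patchE; case: ifPn => zO.
  apply: le_trans (second_moment_potential z QN).
  by apply: ge0_le_integral_any => // y; rewrite /f patchE; case: ifPn => // _;
    rewrite expe2 mule_ge0// potential_ge0.
by rewrite integral0_eq// => y _; rewrite /f patchE in_setX in_setT (negbTE zO).
Qed.

Definition mean_potential (P : probability (PD R) R) (z : plane R) : R :=
  fine (\int[P]_y potential y z).

Lemma sqr_integrable_potential P z : second_moment_bound P ->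
  sqr_integrable P (fun y => fine (potential y z)).
Proof.
move=> PN; split.
  exact: (measurableT_comp (fine_measurable measurableT) (measurable_potentiall z)).
apply: le_lt_trans (le_trans _ (second_moment_potential z PN)) (ltry _).
rewrite le_eqVlt; apply/orP; left; apply/eqP; apply: eq_integral => y _.
by rewrite -[LHS]/((fine (potential y z))%:E ^+ 2) fineK// potential_fin_num.
Qed.

Lemma mean_potentialE P z : second_moment_bound P ->
  \int[P]_y potential y z = (mean_potential P z)%:E.
Proof.
move=> PN; rewrite fineK//.
have := integrable_fin_num measurableT
  (sqr_integrable_integrable (sqr_integrable_potential z PN)).
by under eq_integral do rewrite /= fineK ?potential_fin_num//.
Qed.

Lemma measurable_mean_potential P : measurable_fun setT (mean_potential P).
Proof.
apply: (measurableT_comp (fine_measurable measurableT)).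
apply: (@measurable_fun_fubini_tonelli_G _ _ _ _ _ P
  (fun q => potential q.1 q.2)) => //; first exact: measurable_potential.
by move=> q; exact: potential_ge0.
Qed.

Lemma mean_potential_ge0 P z : (0 <= mean_potential P z)%R.
Proof. by rewrite fine_ge0// integral_ge0// => y _; exact: potential_ge0. Qed.

Lemma mean_Kfine P y : second_moment_bound P ->
  \int[P]_x (Kfine x y)%:E = \int[pdfin y]_z (tw z * mean_potential P z)%:E.
Proof.
move=> PN.
pose f (q : PD R * plane R) := (tw q.2)%:E * potential q.1 q.2.
have mf : measurable_fun setT f.
  apply: emeasurable_funM; last exact: measurable_potential.
  by apply/measurable_EFinP; exact: (measurableT_comp mtw).
have f0 q : 0 <= f q.
  by rewrite mule_ge0 ?potential_ge0// lee_fin trunc_weight_ge0.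
transitivity (\int[P]_x \int[pdfin y]_z f (x, z)).
  by apply: eq_integral => x _; rewrite KfineC -KfineE.
rewrite (@fubini_tonelli _ _ _ _ _ P (pdfin y) f mf f0).
apply: eq_integral => z _; rewrite EFinM -mean_potentialE// -ge0_integralZl//.
- exact: measurable_potentiall.
- by move=> x _; exact: potential_ge0.
- by rewrite lee_fin trunc_weight_ge0.
Qed.

(** The difference of the two means is one integral against y, and its absolute value has the form
    handled by [second_moment_bound], with u the difference of the mean potentials. *)
Lemma mean_Kfine_diff P Q y : second_moment_bound P -> second_moment_bound Q ->
  ((fine (\int[P]_x (Kfine x y)%:E) - fine (\int[Q]_x (Kfine x y)%:E)) ^+ 2)%:E
  <= (\int[pdfin y]_z `|tw z * (mean_potential P z - mean_potential Q z)|%:E) ^+ 2.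
Proof.
move=> PN QN.
have int S : second_moment_bound S ->
    (pdfin y).-integrable setT (fun z => (tw z * mean_potential S z)%:E).
  move=> SN; apply/integrableP; split.
    apply/measurable_EFinP; apply: measurable_funM => //.
    exact: measurable_mean_potential.
  have nn z : (0 <= tw z * mean_potential S z)%R.
    by apply: mulr_ge0; [exact: trunc_weight_ge0|exact: mean_potential_ge0].
  under eq_integral do rewrite gee0_abs ?lee_fin ?nn//.
  rewrite -mean_Kfine//; exact: Kfine_integrable.
have iP := int _ PN; have iQ := int _ QN.
rewrite !mean_Kfine//.
have -> : (fine (\int[pdfin y]_z (tw z * mean_potential P z)%:E) -
     fine (\int[pdfin y]_z (tw z * mean_potential Q z)%:E))%R =
   fine (\int[pdfin y]_z (tw z * (mean_potential P z - mean_potential Q z))%:E).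
  under [in RHS]eq_integral do rewrite mulrBr.
  rewrite integralB_EFin//; apply/esym.
  exact: (fineB (integrable_fin_num measurableT iP) (integrable_fin_num measurableT iQ)).
have iPQ : (pdfin y).-integrable setT
    (fun z => (tw z * (mean_potential P z - mean_potential Q z))%:E).
  under eq_fun do rewrite mulrBr EFinB.
  exact: (integrableB measurableT iP iQ).
have fPQ := integrable_fin_num measurableT iPQ.
have le := le_abse_integral (pdfin y) measurableT (measurable_int _ iPQ).
have lef : `|fine (\int[pdfin y]_z (tw z * (mean_potential P z - mean_potential Q z))%:E)|%:E
   <= \int[pdfin y]_z `|tw z * (mean_potential P z - mean_potential Q z)|%:E.
  rewrite -[leLHS]/(`|(fine (\int[pdfin y]_z (tw z * (mean_potential P z -
    mean_potential Q z))%:E))%:E|) fineK//.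
rewrite -real_normK ?num_real// expr2 EFinM expe2.
by apply: lee_pmul.
Qed.

Lemma integrable_potential y z : (pdfin y).-integrable setT
  (fun z' => (tw z' * kl z z')%:E).
Proof.
apply/integrableP; split.
  by apply/measurable_EFinP; exact: measurable_twkl.
have nn z' : (0 <= tw z' * kl z z')%R.
  by apply: mulr_ge0; [exact: trunc_weight_ge0|exact: klam_ge0].
under eq_integral do rewrite gee0_abs ?lee_fin ?nn//.
rewrite -ge0_fin_numE; first exact: potential_fin_num.
by apply: integral_ge0 => z' _; rewrite lee_fin.
Qed.

Lemma Klam_regular x y : regular_pd M x -> regular_pd M y ->
  Klam w k1 k2 lam x y = Kfine x y.
Proof.
move=> xr yr; have [xoo _] := xr; have [yoo _] := yr; rewrite /Klam /Kfine; congr fine.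
have inner z : \int[pd_eval y]_z' (w z * w z' * kl z z')%:E = (w z)%:E * potential y z.
  rewrite -integralZl//; last exact: integrable_potential.
  rewrite integral_pdfin//; apply: ae_eq_integral_any.
    apply: measurable_funeM; apply/measurable_EFinP; exact: measurable_twkl.
  apply: filterS (ae_OmegaM_regular yr) => z' z'O.
  by rewrite trunc_weightE// -EFinM -mulrA.
under eq_integral do rewrite inner.
rewrite integral_pdfin//; apply: ae_eq_integral_any.
  apply: emeasurable_funM; first exact/measurable_EFinP.
  exact: measurable_potentialr.
by apply: filterS (ae_OmegaM_regular xr) => z zO; rewrite trunc_weightE.
Qed.

(** * Mean potentials as integrals against the intensity *)

Section intensity.
Variables (F : fieldType) (P : probability (PD R) R) (p : plane R -> R).
Hypothesis PP : classP F M N w P.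
Hypothesis Pp : is_intensity P p.

Let mp : measurable_fun setT p. Proof. by case: Pp. Qed.
Let p0 z : (0 <= p z)%R. Proof. by case: Pp. Qed.

Lemma ae_regular : {ae P, forall x, regular_pd M x}.
Proof.
exists (~` regular_pd M); split => //.
- by apply: measurableC; exact: measurable_regular_pd.
- exact: classP_regular PP.
Qed.

Lemma integral_intensity (f : plane R -> \bar R) :
  measurable_fun setT f -> (forall z, 0 <= f z) ->
  \int[P]_x \int[pdfin x]_z f z = \int[leb2]_z (f z * (p z)%:E).
Proof.
move=> mf f0; case: Pp => _ _ pO pdens.
have dens A : measurable A -> A `<=` Omega ->
    \int[P]_(t in setT) pd_eval t A = 1%:E * \int[leb2]_(z in A) (p z)%:E.
  by move=> mA AO; rewrite mul1e -pdens.
have [mI ID] := @integral_mean_measure R _ _ P setT measurableT id 1%R p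
  (@measurable_id _ _ _) mp p0 pO dens f mf f0.
rewrite mul1e in ID; rewrite -ID.
apply: ge0_ae_eq_integral_any => //.
- by move=> x; exact: integral_ge0.
- by move=> x; exact: integral_ge0.
- by apply: filterS ae_regular => x [xoo _]; rewrite integral_pdfin.
Qed.

(** The integral of p over the complement of [OmegaM M] is the expected number of points there,
    which is 0. *)
Lemma ae_intensity_OmegaM : {ae leb2, forall z, ~ OmegaM M z -> p z = 0%R}.
Proof.
have mO := @measurable_OmegaM R M.
have mOC : measurable (~` OmegaM M) by exact: measurableC.
have mi : measurable_fun setT (fun z => (\1_(~` OmegaM M) z)%:E : \bar R).
  by apply/measurable_EFinP; exact: measurable_indic.
have i0 : \int[P]_x \int[pdfin x]_z (\1_(~` OmegaM M) z)%:E = 0.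
  rewrite (@ae_eq_integral_any _ _ _ P _ (cst 0))//; first exact: integral0.
  apply: filterS ae_regular => x [xoo xM].
  by rewrite integral_indic// setIT -[LHS]/(pdfin x _) pdfinE.
rewrite (integral_intensity mi) in i0; last by move=> z; rewrite lee_fin.
have mip : measurable_fun setT (fun z => (\1_(~` OmegaM M) z)%:E * (p z)%:E : \bar R).
  by apply: emeasurable_funM => //; exact/measurable_EFinP.
have : ae_eq leb2 setT (fun z => (\1_(~` OmegaM M) z)%:E * (p z)%:E) (cst 0).
  apply/(ae_eq_integral_abs leb2 measurableT mip); rewrite -[RHS]i0.
  by apply: eq_integral => z _; rewrite gee0_abs// mule_ge0 ?lee_fin.
apply: filterS => z /(_ I)/= h zO; move: h; rewrite indicE mem_set// mul1e.
by move=> /eqP; rewrite eqe => /eqP.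
Qed.

Lemma mean_potential_density z :
  leb2.-integrable setT (fun z' => (tw z' * p z' * kl z z')%:E) /\
  \int[leb2]_z' (tw z' * p z' * kl z z')%:E = (mean_potential P z)%:E.
Proof.
have PN := classP_second_moment N0 mw PP.
have nn z' : (0 <= tw z' * kl z z')%R.
  by apply: mulr_ge0; [exact: trunc_weight_ge0|exact: klam_ge0].
have mt : measurable_fun setT (fun z' => (tw z' * kl z z')%:E).
  by apply/measurable_EFinP; exact: measurable_twkl.
have e : \int[leb2]_z' (tw z' * p z' * kl z z')%:E = (mean_potential P z)%:E.
  rewrite -(mean_potentialE z PN).
  rewrite [RHS](integral_intensity mt); last by move=> z'; rewrite lee_fin.
  by apply: eq_integral => z' _; rewrite -EFinM mulrAC.
split => //; apply/integrableP; split.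
  apply/measurable_EFinP; apply: measurable_funM; first exact: measurable_funM.
  exact: measurable_klamr.
have nn' z' : (0 <= tw z' * p z' * kl z z')%R by rewrite mulrAC; exact: mulr_ge0.
under eq_integral do rewrite gee0_abs ?lee_fin ?nn'//.
by rewrite e ltry.
Qed.

End intensity.

(** This links the linear projection to the norm in the theorem. Both intensities vanish almost
    everywhere off [OmegaM M], so truncating w changes nothing, and each half is integrable, so the
    integral of the difference splits. *)
Lemma convolution_intensities (F : fieldType) (P Q : probability (PD R) R)
    (p q : plane R -> R) x :
  classP F M N w P -> classP F M N w Q -> is_intensity P p -> is_intensity Q q ->
  convolution (fun z => w z * (p z - q z))%R (phi k1 k2 lam) x =
  (mean_potential P x - mean_potential Q x)%R.
Proof.
move=> PP QQ Pp Qq.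
have [iP eP] := mean_potential_density PP Pp x.
have [iQ eQ] := mean_potential_density QQ Qq x.
have mP : measurable_fun setT p by case: Pp.
have mQ : measurable_fun setT q by case: Qq.
have e : \int[leb2]_z (w z * (p z - q z) * kl x z)%:E =
    \int[leb2]_z (tw z * p z * kl x z - tw z * q z * kl x z)%:E.
  apply: ae_eq_integral_any.
    exact: (measurable_int _ (integrableB measurableT iP iQ)).
  apply: filterS2 (ae_intensity_OmegaM PP Pp) (ae_intensity_OmegaM QQ Qq).
  move=> z pz qz; congr (_%:E); have [zO|zO] := pselect (OmegaM M z).
    by rewrite trunc_weightE//; ring.
  by rewrite pz// qz//; ring.
rewrite /convolution /Rintegral -[X in fine X]/(\int[leb2]_z (w z * (p z - q z) * kl x z)%:E).
by rewrite e integralB_EFin// eP eQ.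
Qed.

End diagram_kernel.

(** * The statistic *)

Section quadratic_statistic.
Variables (R : realType) (n m : nat).
Hypothesis n2 : (2 <= n)%N.
Hypothesis m2 : (2 <= m)%N.

Lemma sum_neq_l (k : nat) (f : 'I_k -> R) : (0 < k)%N ->
  \sum_(i < k) \sum_(i' < k | i != i') f i = (k%:R - 1) * \sum_(i < k) f i.
Proof.
move=> k0; rewrite mulr_sumr; apply: eq_bigr => i _.
rewrite (eq_bigl (predC1 i)) => [|i']; last by rewrite /= eq_sym.
by rewrite sumr_const cardC1 card_ord -[LHS]mulr_natl -subn1 natrB.
Qed.

Lemma sum_neq_r (k : nat) (f : 'I_k -> R) : (0 < k)%N ->
  \sum_(i < k) \sum_(i' < k | i != i') f i' = (k%:R - 1) * \sum_(i < k) f i.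
Proof.
move=> k0; rewrite -sum_neq_l//.
rewrite (exchange_big_dep xpredT)//=; apply: eq_bigr => i _.
by apply: eq_bigl => i'; rewrite eq_sym.
Qed.

(** Weights that make the two-sample statistic a single quadratic form in the pooled sample. The
    cross weight is -1 / (n m) because each cross pair is met in both orders. *)
Definition coef (s t : 'I_n + 'I_m) : R :=
  match s, t with
  | inl i, inl i' => if i == i' then 0 else (n%:R * (n%:R - 1))^-1
  | inr j, inr j' => if j == j' then 0 else (m%:R * (m%:R - 1))^-1
  | _, _ => - (n%:R * m%:R)^-1
  end.

Lemma coefC s t : coef s t = coef t s.
Proof. by case: s t => [i|j] [i'|j'] //=; rewrite eq_sym. Qed.

Lemma coefss s : coef s s = 0.
Proof. by case: s => [i|j] /=; rewrite eqxx. Qed.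

Let n0 : (n%:R : R) != 0. Proof. by rewrite pnatr_eq0 -lt0n (ltn_trans _ n2). Qed.
Let m0 : (m%:R : R) != 0. Proof. by rewrite pnatr_eq0 -lt0n (ltn_trans _ m2). Qed.
Let n10 : (n%:R - 1 : R) != 0.
Proof. by rewrite subr_eq0 pnatr_eq1 gtn_eqF. Qed.
Let m10 : (m%:R - 1 : R) != 0.
Proof. by rewrite subr_eq0 pnatr_eq1 gtn_eqF. Qed.
Let n1 : (0 < n)%N. Proof. exact: ltn_trans n2. Qed.
Let m1 : (0 < m)%N. Proof. exact: ltn_trans m2. Qed.

Lemma sum_coef (H : 'I_n + 'I_m -> 'I_n + 'I_m -> R) :
  \sum_s \sum_t coef s t * H s t =
  (n%:R * (n%:R - 1))^-1 * (\sum_i \sum_(i' | i != i') H (inl i) (inl i'))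
  + (m%:R * (m%:R - 1))^-1 * (\sum_j \sum_(j' | j != j') H (inr j) (inr j'))
  - (n%:R * m%:R)^-1 * (\sum_i \sum_j (H (inl i) (inr j) + H (inr j) (inl i))).
Proof.
have diag k (a : R) (G : 'I_k -> 'I_k -> R) :
    \sum_i \sum_i' (if i == i' then 0 else a) * G i i' =
    a * \sum_i \sum_(i' | i != i') G i i'.
  rewrite mulr_sumr; apply: eq_bigr => i _; rewrite mulr_sumr [RHS]big_mkcond/=.
  by apply: eq_bigr => i' _; case: eqP => //=; rewrite mul0r.
rewrite big_sumType/=; under eq_bigr do rewrite big_sumType/=.
under [X in _ + X = _]eq_bigr do rewrite big_sumType/=.
rewrite !big_split/= !diag.
have -> : \sum_i \sum_j (H (inl i) (inr j) + H (inr j) (inl i)) =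
    \sum_i \sum_j H (inl i) (inr j) + \sum_i \sum_j H (inr j) (inl i).
  by rewrite -big_split; apply: eq_bigr => i _; rewrite -big_split.
have pull k k' (a : R) (G : 'I_k -> 'I_k' -> R) :
    \sum_i \sum_j a * G i j = a * \sum_i \sum_j G i j.
  by rewrite mulr_sumr; apply: eq_bigr => i _; rewrite mulr_sumr.
rewrite !pull [X in _ + (_ * X + _) = _]exchange_big/=.
by ring.
Qed.

(** Each term of the summand involves two of the four indices; summing over the idle ones gives m(m
    - 1), n(n - 1) or, for the two cross terms, (n - 1)(m - 1). *)
Lemma ustatistic_coef (H : 'I_n + 'I_m -> 'I_n + 'I_m -> R) :
  (forall s t, H s t = H t s) ->
  (n%:R * (n%:R - 1) * m%:R * (m%:R - 1))^-1 *
  \sum_(i < n) \sum_(i' < n | i != i') \sum_(j < m) \sum_(j' < m | j != j')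
    (H (inl i) (inl i') + H (inr j) (inr j') - H (inl i) (inr j') - H (inl i') (inr j))
  = \sum_s \sum_t coef s t * H s t.
Proof.
move=> HC; rewrite sum_coef.
under [X in _ - _ * X]eq_bigr do under eq_bigr do rewrite [H (inr _) _]HC.
pose A := \sum_i \sum_(i' | i != i') H (inl i) (inl i').
pose B := \sum_j \sum_(j' | j != j') H (inr j) (inr j').
pose D := \sum_i \sum_j H (inl i) (inr j).
rewrite (_ : \sum_(i < n) _ = m%:R * (m%:R - 1) * A + n%:R * (n%:R - 1) * B
  - 2 * ((n%:R - 1) * (m%:R - 1) * D)); last first.
  have cst k (a : R) : (0 < k)%N ->
      \sum_(i < k) \sum_(i' < k | i != i') a = k%:R * (k%:R - 1) * a.
    move=> k0; rewrite (sum_neq_l (fun=> a) k0) sumr_const card_ord -mulr_natl.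
    by ring.
  have inner i i' : \sum_j \sum_(j' | j != j')
      (H (inl i) (inl i') + H (inr j) (inr j') - H (inl i) (inr j') - H (inl i') (inr j)) =
      m%:R * (m%:R - 1) * H (inl i) (inl i') + B
      - (m%:R - 1) * \sum_j H (inl i) (inr j) - (m%:R - 1) * \sum_j H (inl i') (inr j).
    under eq_bigr => j _ do rewrite !sumrB big_split/=.
    rewrite !sumrB big_split/= cst// -/B.
    by rewrite (sum_neq_r (fun j => H (inl i) (inr j)) m1)
      (sum_neq_l (fun j => H (inl i') (inr j)) m1).
  under eq_bigr => i _ do under eq_bigr => i' _ do rewrite inner.
  under eq_bigr => i _ do rewrite !sumrB big_split/=.
  rewrite !sumrB big_split/= cst//.
  rewrite (sum_neq_l (fun i => (m%:R - 1) * \sum_j H (inl i) (inr j)) n1).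
  rewrite (sum_neq_r (fun i => (m%:R - 1) * \sum_j H (inl i) (inr j)) n1).
  rewrite -mulr_sumr -/D.
  under eq_bigr => i _ do rewrite -mulr_sumr.
  rewrite -mulr_sumr -/A.
  by clearbody A B D; ring.
rewrite (_ : \sum_i \sum_j (_ + _) = 2 * D); last first.
  rewrite /D mulr_sumr; apply: eq_bigr => i _; rewrite mulr_sumr.
  by apply: eq_bigr => j _; ring.
rewrite -/A -/B; clearbody A B D.
by field; rewrite n0 m0 n10 m10.
Qed.

(** The sum equals 1/(n(n - 1)) + 1/(m(m - 1)) + 2/(n m), and n(n - 1) >= n^2 / 2 for n >= 2. This
    is the source of the order (n + m)^-2. *)
Lemma sum_coef_sqr : \sum_s \sum_t coef s t ^+ 2 <=
  2 * (n%:R^-1 + m%:R^-1) ^+ 2.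
Proof.
under eq_bigr do under eq_bigr do rewrite expr2.
rewrite sum_coef/=.
have half k : (2 <= k)%N -> (k%:R * (k%:R - 1))^-1 <= 2 * (k%:R^-1) ^+ 2 :> R.
  move=> k2; have kR : 2 <= k%:R :> R by rewrite ler_nat.
  have k0 : 0 < k%:R :> R by lra.
  have k1 : 0 < k%:R - 1 :> R by lra.
  rewrite -[leLHS]mul1r ler_pdivrMr ?mulr_gt0//.
  have -> : 2 * k%:R^-1 ^+ 2 * (k%:R * (k%:R - 1)) = 2 - 2 * k%:R^-1 :> R.
    by field; rewrite gt_eqF.
  have : k%:R^-1 <= 2^-1 :> R by rewrite lef_pV2// posrE//.
  by lra.
have diag k (a : R) : (0 < k)%N ->
    \sum_(i < k) \sum_(i' < k | i != i') (if i == i' then 0 else a) =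
    k%:R * (k%:R - 1) * a.
  move=> k0; transitivity (\sum_(i < k) \sum_(i' < k | i != i') a).
    by apply: eq_bigr => i _; apply: eq_bigr => i' /negbTE ->.
  rewrite (sum_neq_l (fun=> a) k0) sumr_const card_ord -mulr_natl.
  by ring.
have const (a : R) : \sum_(i < n) \sum_(j < m) a = n%:R * (m%:R * a).
  by rewrite !sumr_const !card_ord -[LHS]mulr_natl -[X in _ * X = _]mulr_natl.
rewrite !diag// const.
have hn := half _ n2; have hm := half _ m2.
have -> : (n%:R * (n%:R - 1))^-1 * (n%:R * (n%:R - 1) * (n%:R * (n%:R - 1))^-1)
    = (n%:R * (n%:R - 1))^-1 :> R by field; rewrite n0 n10.
have -> : (m%:R * (m%:R - 1))^-1 * (m%:R * (m%:R - 1) * (m%:R * (m%:R - 1))^-1)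
    = (m%:R * (m%:R - 1))^-1 :> R by field; rewrite m0 m10.
have -> : (n%:R * m%:R)^-1 * (n%:R * (m%:R * (- (n%:R * m%:R)^-1 - (n%:R * m%:R)^-1)))
    = - (2 * (n%:R^-1 * m%:R^-1)) :> R by field; rewrite n0 m0.
have p : 0 <= n%:R^-1 * m%:R^-1 :> R by rewrite mulr_ge0// invr_ge0.
rewrite sqrrD; lra.
Qed.

(** Each row of weights sums to zero, so only the difference between the two laws survives in the
    linear projection. *)
Lemma sum_coef_row (gP gQ : R) (s : 'I_n + 'I_m) :
  \sum_t coef s t * (match t with inl _ => gP | inr _ => gQ end) =
  match s with inl _ => n%:R^-1 * (gP - gQ) | inr _ => m%:R^-1 * (gQ - gP) end.
Proof.
have row k (a b : R) (i : 'I_k) : \sum_i' (if i == i' then 0 else a) * b =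
    (k%:R - 1) * (a * b).
  rewrite (bigD1 i)//= eqxx mul0r add0r.
  transitivity (\sum_(i' < k | i' != i) (a * b)).
    by apply: eq_bigr => i' /negbTE; rewrite eq_sym => ->.
  rewrite sumr_const cardC1 card_ord -[LHS]mulr_natl -subn1 natrB//.
  exact: leq_trans (ltn_ord i).
by rewrite big_sumType/=; case: s => [i|j] /=; rewrite row sumr_const card_ord
  -mulr_natl; field; rewrite ?n0 ?m0 ?n10 ?m10.
Qed.

End quadratic_statistic.

Section assembly.
Local Open Scope ereal_scope.

(** Measurability is asked of g alone, so that f can be the statistic and g its quadratic form in
    [Kfine]. *)
Lemma ae_eq_variance (R : realType) d (T : measurableType d) (Pr : probability T R)
    (f g : T -> R) : measurable_fun setT g ->
  {ae Pr, forall t, f t = g t} -> variance Pr f = variance Pr g.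
Proof.
move=> mg fg; rewrite /variance unlock expectation.unlock.
have -> : \int[Pr]_t (f t)%:E = \int[Pr]_t (g t)%:E.
  apply: ae_eq_integral_any; first exact/measurable_EFinP.
  by apply: filterS fg => t ->.
apply: ae_eq_integral_any.
  by apply/measurable_EFinP; apply: measurable_funM; exact: measurable_funB.
by apply: filterS fg => t fgt; rewrite fctE /= fgt.
Qed.

Lemma Lnorm2_sqr (R : realType) d (T : measurableType d)
    (mu : {measure set T -> \bar R}) (f : T -> R) :
  'N[mu]_2%:E[(fun x => (f x)%:E)] ^+ 2 = \int[mu]_x (f x ^+ 2)%:E.
Proof.
rewrite -poweR2 ?Lnorm_ge0// powR_Lnorm//.
by apply: eq_integral => t _; rewrite /= powR_mulrn// real_normK ?num_real.
Qed.

End assembly.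

(** * The variance bound for given laws, bandwidths and sample sizes *)

Section variance_bound.
Local Open Scope ereal_scope.
Variables (R : realType) (F : fieldType) (M N B : R) (w : plane R -> R).
Variables (k1 k2 : measurableTypeR R -> R) (lam : R * R).
Hypothesis M0 : (0 < M)%R.
Hypothesis mw : measurable_fun setT w.
Hypothesis w0 : forall z, OmegaM M z -> (0 <= w z)%R.
Hypothesis wB : forall z, OmegaM M z -> (w z <= B)%R.
Hypothesis B0 : (0 <= B)%R.
Hypothesis N0 : (0 < N)%R.
Hypothesis hk1 : kernel_factor k1.
Hypothesis hk2 : kernel_factor k2.
Hypothesis l1 : (0 < lam.1)%R.
Hypothesis l2 : (0 < lam.2)%R.
Variables (P Q : probability (PD R) R) (p q : plane R -> R).
Hypothesis PP : classP F M N w P.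
Hypothesis QQ : classP F M N w Q.
Hypothesis Pp : is_intensity P p.
Hypothesis Qq : is_intensity Q q.
Variables (n m : nat) (d : measure_display) (T : measurableType d).
Variables (Pr : probability T R) (X : 'I_n -> T -> PD R) (Y : 'I_m -> T -> PD R).
Hypothesis n2 : (2 <= n)%N.
Hypothesis m2 : (2 <= m)%N.
Hypothesis XY : independent_samples Pr P Q X Y.

Local Notation K := (Kfine M w k1 k2 lam).

Let Z (s : 'I_n + 'I_m) : T -> PD R :=
  match s with inl i => X i | inr j => Y j end.

Let law (s : 'I_n + 'I_m) : probability (PD R) R :=
  match s with inl _ => P | inr _ => Q end.

Let mZ s : measurable_fun setT (Z s).
Proof. by case: XY => hX hY _; case: s => [i|j]; [case: (hX i)|case: (hY j)]. Qed.

Let lawZ s A : measurable A -> Pr (Z s @^-1` A) = law s A.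
Proof.
by case: XY => hX hY _; case: s => [i|j]; [case: (hX i) => _; exact|case: (hY j) => _; exact].
Qed.

Let indZ : mutually_independent Pr Z.
Proof. by case: XY. Qed.

Let lawN s : second_moment_bound M N w (law s).
Proof. by case: s => [i|j]; [exact: classP_second_moment PP|exact: classP_second_moment QQ]. Qed.

Let mK := measurable_Kfine mw w0 hk1 hk2 l1 l2.
Let K0 := Kfine_ge0 w0 hk1 hk2 l1 l2.
Let KC := KfineC mw w0 wB B0 hk1 hk2 l1 l2.
Let Kfin s y : \int[law s]_x (K x y)%:E < +oo.
Proof. exact: (Kfine_integrable M0 mw w0 wB B0 N0 hk1 hk2 l1 l2). Qed.
Let K2 s t : \int[law t]_y \int[law s]_x (K x y ^+ 2)%:E
  <= (N ^+ 2 * klam_norm k1 k2 lam * M ^+ 2)%:E.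
Proof. exact: (second_moment_Kfine2 M0 mw w0 wB B0 N0 hk1 hk2 l1 l2). Qed.

Lemma ae_regular_samples : {ae Pr, forall t, forall s, regular_pd M (Z s t)}.
Proof.
apply: (@filter_forall T _ (fun s => [set t | regular_pd M (Z s t)])) => s.
exists (Z s @^-1` (~` regular_pd M)); split => //.
  rewrite -[X in measurable X]setTI; apply: mZ => //.
  by apply: measurableC; exact: measurable_regular_pd.
rewrite lawZ; last by apply: measurableC; exact: measurable_regular_pd.
by case: s => [i|j]; [exact: classP_regular PP|exact: classP_regular QQ].
Qed.

Lemma ae_That : {ae Pr, forall t,
  That w k1 k2 lam (fun i => X i t) (fun j => Y j t) =
  quadratic_form Z K (@coef R n m) t}.
Proof.
apply: filterS ae_regular_samples => t reg.
pose H s u := K (Z s t) (Z u t).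
have HC s u : H s u = H u s by exact: KC.
rewrite /quadratic_form -(ustatistic_coef n2 m2 HC) /That; congr (_ * _)%R.
have KH s u : Klam w k1 k2 lam (Z s t) (Z u t) = H s u.
  exact: (Klam_regular mw w0 wB B0 hk1 hk2 l1 l2 (reg s) (reg u)).
apply: eq_bigr => i _; apply: eq_bigr => i' _; apply: eq_bigr => j _.
apply: eq_bigr => j' _.
by rewrite /hlam -!KH.
Qed.

(** By [sum_coef_row] the projection at s is, up to sign, 1/n or 1/m times the difference of the
    means of the kernel under P and Q. The second moment bound then applies, and the difference of
    the mean potentials is the convolution. *)
Lemma projection_sqr_le s :
  \int[law s]_x (projection law K (@coef R n m) s x ^+ 2)%:E <=
  ((match s with inl _ => n%:R^-1 | inr _ => m%:R^-1 end) ^+ 2 * N)%:E *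
  'N[leb2]_2%:E[(fun x =>
    (convolution (fun z => w z * (p z - q z)) (phi k1 k2 lam) x)%:E)] ^+ 2.
Proof.
set r := (match s with inl _ => _ | inr _ => _ end).
pose f z := (mean_potential M w k1 k2 lam P z - mean_potential M w k1 k2 lam Q z)%R.
have mf : measurable_fun setT f.
  by apply: measurable_funB; exact: measurable_mean_potential.
(* An index of each sample is named only to read off the moment bounds for P and Q. *)
have PN := lawN (inl (Ordinal (ltn_trans (ltnSn 0) n2))).
have QN := lawN (inr (Ordinal (ltn_trans (ltnSn 0) m2))).
have proj_le x : (projection law K (@coef R n m) s x ^+ 2)%:E <=
    (r ^+ 2)%:E * (\int[pdfin x]_z `|trunc_weight M w z * f z|%:E) ^+ 2.
  have -> : (projection law K (@coef R n m) s x ^+ 2 = r ^+ 2 *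
      (fine (\int[P]_y (K y x)%:E) - fine (\int[Q]_y (K y x)%:E)) ^+ 2)%R.
    rewrite -exprMn.
    have := sum_coef_row n2 m2 (fine (\int[P]_y (K y x)%:E))
      (fine (\int[Q]_y (K y x)%:E)) s.
    have -> : (\sum_t @coef R n m s t * (match t with
        | inl _ => fine (\int[P]_y (K y x)%:E)
        | inr _ => fine (\int[Q]_y (K y x)%:E) end) =
        projection law K (@coef R n m) s x)%R.
      by apply: eq_bigr => -[i|j] _.
    move=> ->; rewrite /r; case: s @r => [i|j] //=.
    by rewrite -[(_ * (_ - _))%R]opprK sqrrN -mulrN opprB.
  rewrite EFinM; apply: lee_wpmul2l; first by rewrite lee_fin sqr_ge0.
  exact: (mean_Kfine_diff M0 mw w0 wB B0 N0 hk1 hk2 l1 l2).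
apply: (@le_trans _ _ (\int[law s]_x ((r ^+ 2)%:E *
    (\int[pdfin x]_z `|trunc_weight M w z * f z|%:E) ^+ 2))).
  by apply: ge0_le_integral_any => // x; rewrite lee_fin sqr_ge0.
rewrite ge0_integralZl//; last 3 first.
- under eq_fun do rewrite expe2.
  have mI : measurable_fun setT (fun x : PD R =>
      \int[pdfin x]_z `|trunc_weight M w z * f z|%:E).
    apply: (@measurable_integral_pdfin _ _ _ id _
      (fun xz => `|trunc_weight M w xz.2 * f xz.2|%:E)) => //.
    have mtf : measurable_fun setT (fun z => `|trunc_weight M w z * f z|%R).
      apply: measurableT_comp => //; apply: measurable_funM => //.
      exact: measurable_trunc_weight.
    by apply/measurable_EFinP; exact: (measurableT_comp mtf).
  exact: emeasurable_funM.
- by move=> x _; rewrite expe2 mule_ge0// integral_ge0.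
- by rewrite lee_fin sqr_ge0.
rewrite [X in _ <= X * _]EFinM -muleA.
apply: lee_wpmul2l; first by rewrite lee_fin sqr_ge0.
apply: le_trans (lawN s mf) _; apply: lee_wpmul2l; first by rewrite lee_fin ltW.
rewrite Lnorm2_sqr.
have -> : \int[leb2]_x ((convolution (fun z => w z * (p z - q z)) (phi k1 k2 lam) x) ^+ 2)%:E
    = \int[leb2]_x (f x ^+ 2)%:E.
  apply: eq_integral => x _.
  by rewrite (convolution_intensities mw w0 wB B0 N0 hk1 hk2 l1 l2 x PP QQ Pp Qq).
apply: ge0_subset_integral => //.
- exact: measurable_OmegaM.
- exact: measurable_sqr.
- by move=> z _; rewrite lee_fin sqr_ge0.
Qed.

(** Summing the projection bounds gives n / n^2 + m / m^2 = 1/n + 1/m, and 512 is 256 times the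
    factor 2 of [sum_coef_sqr]. *)
Lemma variance_That_le :
  variance Pr (fun t => That w k1 k2 lam (fun i => X i t) (fun j => Y j t)) <=
  (256 * N * (n%:R^-1 + m%:R^-1))%:E *
  'N[leb2]_2%:E[(fun x =>
    (convolution (fun z => w z * (p z - q z)) (phi k1 k2 lam) x)%:E)] ^+ 2
  + (512 * (N ^+ 2 * klam_norm k1 k2 lam * M ^+ 2) * (n%:R^-1 + m%:R^-1) ^+ 2)%:E.
Proof.
have coefC' s t := @coefC R n m s t.
have mq := (sqr_integrable_quadratic_form mZ lawZ indZ mK K0 K2
  coefC' (@coefss R n m)).1.
rewrite (ae_eq_variance mq ae_That).
apply: le_trans (variance_quadratic_form_le mZ lawZ indZ mK K0 KC Kfin K2
  coefC' (@coefss R n m)) _.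
set G := 'N[leb2]_2%:E[_] ^+ 2.
have G0 : 0 <= G by rewrite /G expe2 mule_ge0// Lnorm_ge0.
have beta0 : (0 <= N ^+ 2 * klam_norm k1 k2 lam * M ^+ 2)%R.
  apply: mulr_ge0; last exact: sqr_ge0.
  by apply: mulr_ge0; [exact: sqr_ge0|exact: klam_norm_ge0].
apply: leeD; last first.
  rewrite lee_fin; have := sum_coef_sqr R n2 m2.
  set S := (\sum_s _)%R => S_le.
  apply: le_trans (ler_wpM2l (mulr_ge0 (ler0n _ _) beta0) S_le) _.
  by rewrite le_eqVlt; apply/orP; left; apply/eqP; ring.
rewrite -!mulrA EFinM -muleA.
apply: lee_wpmul2l; first by rewrite lee_fin ler0n.
apply: le_trans (lee_sum _ (fun s _ => projection_sqr_le s)) _.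
rewrite -ge0_sume_distrl; last first.
  by move=> s _; rewrite lee_fin mulr_ge0 ?sqr_ge0// ltW.
apply: lee_wpmul2r => //; rewrite sumEFin lee_fin big_sumType/=.
rewrite !sumr_const !card_ord -[X in (X + _)%R]mulr_natl -[X in (_ + X)%R]mulr_natl.
have hn : (n%:R : R) != 0%R by rewrite pnatr_eq0 -lt0n (ltn_trans _ n2).
have hm : (m%:R : R) != 0%R by rewrite pnatr_eq0 -lt0n (ltn_trans _ m2).
by rewrite le_eqVlt; apply/orP; left; apply/eqP; field; rewrite hn hm.
Qed.

End variance_bound.

Theorem lemma4p2 (R : realType) (M N : R) (w : plane R -> R) (k1 k2 : R -> R)
    (c C : R) (hM : 0 < M) (hN : 0 < N) (hw : weight M w)
    (hk1 : kernel_factor k1) (hk2 : kernel_factor k2)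
    (hc : 0 < c) (hcC : c <= C) :
  exists2 C1 : R, 0 < C1 &
    forall (F : fieldType) (P Q : probability (PD R) R) (p q : plane R -> R)
      (lam : R * R) (n m : nat)
      (d : measure_display) (T : measurableType d) (Pr : probability T R)
      (X : 'I_n -> T -> PD R) (Y : 'I_m -> T -> PD R),
    classP F M N w P -> classP F M N w Q ->
    is_intensity P p -> is_intensity Q q ->
    ~ {ae leb2, forall z, p z = q z} ->
    0 < lam.1 -> 0 < lam.2 ->
    (2 <= n)%N -> (2 <= m)%N ->
    c * m%:R <= n%:R -> n%:R <= C * m%:R ->
    independent_samples Pr P Q X Y ->
    (variance Pr (fun t => That w k1 k2 lam (fun i => X i t) (fun j => Y j t))
     <= C1%:E *
        ('N[leb2]_2%:E[(fun x =>
            (convolution (fun z => w z * (p z - q z)) (phi k1 k2 lam) x)%:E)] ^+ 2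
           * ((n + m)%:R^-1)%:E
         + (((n + m)%:R ^+ 2 * lam.1 * lam.2)^-1)%:E))%E.
Proof.
have [[smooth_w _] w_gt0 _ [B' wB']] := hw.
have mw : measurable_fun setT w := continuous_measurable_plane (smooth_w 0%N).
have w0 z : OmegaM M z -> 0 <= w z by move=> /w_gt0/ltW.
(* From (w - 1)^2 >= 0 and w >= 0 one gets w <= 2 w <= w^2 + 1. B serves finiteness arguments and
   does not enter [C1]. *)
pose B := `|B'| + 1.
have B0 : 0 <= B by rewrite addr_ge0.
have wB z : OmegaM M z -> w z <= B.
  move=> zO; have := le_trans (wB' z zO) (ler_norm B').
  by have := sqr_ge0 (w z - 1); rewrite sqrrB1 /B; have := w0 z zO; lra.
(* (1/n + 1/m)(n + m) = 2 + m/n + n/m, and the two ratios are at most 1/c and C. *)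
pose A := 2 + C + c^-1.
have A0 : 0 < A by rewrite /A !addr_gt0 ?invr_gt0// (lt_le_trans hc).
(* The part of [klam_norm] that does not depend on lambda: [klam_norm] is [kap] divided by lam1
   lam2. *)
pose kap := fine (\int[lebesgue_measure]_z ((k1 z) ^+ 2)%:E
  * \int[lebesgue_measure]_z ((k2 z) ^+ 2)%:E)%E.
have kap0 : 0 <= kap.
  by rewrite fine_ge0// mule_ge0// integral_ge0// => z _; rewrite lee_fin sqr_ge0.
(* The two coefficients of [variance_That_le], with A replacing the sample sizes and [kap] the
   bandwidths; each is at most their sum, and the added 1 gives positivity at once. *)
pose C1 := 256 * N * A + 512 * (N ^+ 2 * kap * M ^+ 2) * A ^+ 2 + 1.
have cN : 0 <= 256 * N := mulr_ge0 (ler0n _ _) (ltW hN).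
have c10 : 0 <= 256 * N * A := mulr_ge0 cN (ltW A0).
have c512 : 0 <= 512 :> R := ler0n _ _.
have c20 : 0 <= 512 * (N ^+ 2 * kap * M ^+ 2) * A ^+ 2.
  apply: mulr_ge0 (sqr_ge0 _); apply: mulr_ge0 c512 _.
  exact: mulr_ge0 (mulr_ge0 (sqr_ge0 _) kap0) (sqr_ge0 _).
exists C1; first by rewrite /C1; lra.
move=> F P Q p q lam n m d T Pr X Y PP QQ Pp Qq _ l1 l2 n2 m2 cmn nCm XY.
apply: le_trans (variance_That_le hM mw w0 wB B0 hN hk1 hk2 l1 l2 PP QQ Pp Qq n2 m2 XY) _.
set G := (_ ^+ 2)%E.
have G0 : (0 <= G)%E by rewrite /G expe2 mule_ge0// Lnorm_ge0.
have n0 : 0 < n%:R :> R by rewrite ltr0n (ltn_trans _ n2).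
have m0 : 0 < m%:R :> R by rewrite ltr0n (ltn_trans _ m2).
have nmA : n%:R^-1 + m%:R^-1 <= A * (n + m)%:R^-1.
  have nm0 : 0 < (n + m)%:R :> R by rewrite natrD addr_gt0.
  rewrite ler_pdivlMr// natrD.
  have -> : (n%:R^-1 + m%:R^-1) * (n%:R + m%:R) = 2 + m%:R / n%:R + n%:R / m%:R :> R.
    by field; rewrite !gt_eqF.
  have h1 : m%:R / n%:R <= c^-1 :> R.
    by rewrite ler_pdivrMr// mulrC ler_pdivlMr// mulrC.
  have h2 : n%:R / m%:R <= C :> R by rewrite ler_pdivrMr.
  by rewrite /A; lra.
have nm0 : 0 <= n%:R^-1 + m%:R^-1 :> R by rewrite addr_ge0 ?invr_ge0 ?ltW.
have knorm : klam_norm k1 k2 lam = (lam.1 * lam.2)^-1 * kap.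
  rewrite /klam_norm fineM//; apply: fin_numM; rewrite ge0_fin_numE ?kernel_factor_sqr//;
    by apply: integral_ge0 => z _; rewrite lee_fin sqr_ge0.
have V0 : 0 <= ((n + m)%:R ^+ 2 * lam.1 * lam.2)^-1 :> R.
  by rewrite invr_ge0; exact: mulr_ge0 (mulr_ge0 (sqr_ge0 _) (ltW l1)) (ltW l2).
rewrite ge0_muleDr; last 2 first.
- by apply: mule_ge0 => //; rewrite lee_fin invr_ge0.
- by rewrite lee_fin.
apply: leeD.
  rewrite [leRHS]muleCA [leLHS]muleC; apply: lee_wpmul2l => //.
  rewrite -EFinM lee_fin.
  apply: (@le_trans _ _ (256 * N * (A * (n + m)%:R^-1))).
    exact: ler_wpM2l cN _ _ nmA.
  by rewrite mulrA ler_wpM2r ?invr_ge0// /C1; lra.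
rewrite -EFinM lee_fin knorm.
apply: (@le_trans _ _ (512 * (N ^+ 2 * kap * M ^+ 2) * A ^+ 2 *
    ((n + m)%:R ^+ 2 * lam.1 * lam.2)^-1)); last first.
  by rewrite ler_wpM2r// /C1; lra.
have -> : 512 * (N ^+ 2 * kap * M ^+ 2) * A ^+ 2 * ((n + m)%:R ^+ 2 * lam.1 * lam.2)^-1 =
    512 * (N ^+ 2 * ((lam.1 * lam.2)^-1 * kap) * M ^+ 2) * (A * (n + m)%:R^-1) ^+ 2.
  have nmN : (n + m)%:R != 0 :> R by rewrite natrD gt_eqF// addr_gt0.
  by move: ((n + m)%:R : R) nmN => nm nmN; field; rewrite nmN !gt_eqF.
apply: ler_wpM2l.
  apply: mulr_ge0 c512 _; apply: mulr_ge0 (sqr_ge0 _).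
  apply: mulr_ge0 (sqr_ge0 _) _; apply: mulr_ge0 kap0.
  by rewrite invr_ge0; exact: mulr_ge0 (ltW l1) (ltW l2).
by apply: lerXn2r => //; rewrite nnegrE; apply: mulr_ge0; rewrite ?invr_ge0// ltW.
Qed.
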